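(* Let $F(x,y)\in\mathbb{Z}[x,y]$ be a reducible binary form of degree $n\geq 3$ with discriminant $D$. Assume that either the maximal number of pairwise non-proportional linear forms over $\mathbb{C}$ dividing $F$ is at least $3$, or $F$ is a product of powers of $2$ linear forms with rational coefficients. Let $\epsilon$ be a real number with $0<\epsilon<\frac{1}{4(n-1)}$ and let $m$ be an integer with $$0<m\leq \frac{|D|^{\frac{1}{4(n-1)}-\epsilon}}{(3.5)^{n/2}\, n^{\frac{n}{4(n-1)}}}.$$ Then the inequality $|F(x,y)|\leq m$ has at most $2n+\frac{n}{2(n-1)\epsilon}$ primitive solutions.
   Context: A pair $(x,y)\in\mathbb{Z}^2$ is a primitive solution of an inequality in $x,y$ if it satisfies it and $\gcd(x,y)=1$. Solutions $(x,y)$ and $(-x,-y)$ are regarded as one and the same solution when counting. The discriminant of $F=\prod_{i=1}^n(\alpha_i x-\beta_i y)$ is $D=\prod_{i<j}(\alpha_i\beta_j-\alpha_j\beta_i)^2$. *)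

(* Defs.v *)
From mathcomp Require Import all_boot all_order all_algebra.
From mathcomp Require Import complex mpoly.
From mathcomp Require Import classical_sets cardinality.

Set Implicit Arguments.
Unset Strict Implicit.
Unset Printing Implicit Defensive.

Import Order.TTheory GRing.Theory Num.Theory.
Local Open Scope ring_scope.

(* The variable x is 'X_0 and y is 'X_1. *)
Notation binpoly A := {mpoly A[2]}.

(* n.-homog also holds of the zero polynomial, which has no degree. *)
Definition binary_form (A : idomainType) (n : nat) (F : binpoly A) : Prop :=
  F != 0 /\ F \is n.-homog.

Definition bin_eval (A : comNzRingType) (F : binpoly A) (x y : A) : A :=
  F.@[fun i : 'I_2 => if i == ord0 then x else y].

(* Reducibility is over the rationals: an integer constant is not a proper
   factor. *)
Definition reducible (F : binpoly int) : Prop :=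
  exists G H : binpoly rat,
    [/\ (1 < msize G)%N, (1 < msize H)%N & map_mpoly intr F = G * H].

(* "F has discriminant D"; D does not depend on the choice of factorization. *)
Definition has_discriminant (R : rcfType) (n : nat) (F : binpoly int)
    (D : R[i]) : Prop :=
  exists alpha beta : 'I_n -> R[i],
    map_mpoly intr F
      = \prod_(i < n) (alpha i *: 'X_ord0 - beta i *: 'X_ord_max) :> binpoly R[i]
    /\ D = \prod_(i < n) \prod_(j < n | (i < j)%N)
             (alpha i * beta j - alpha j * beta i) ^+ 2.

Definition proportional (A : idomainType) (L M : binpoly A) : Prop :=
  exists a b : A, [/\ a != 0, b != 0 & a *: L = b *: M].

Definition divides (A : idomainType) (L F : binpoly A) : Prop :=
  exists G : binpoly A, F = L * G.

Definition nonproportional_factors (R : rcfType) (F : binpoly int) (k : nat)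
    (L : 'I_k -> binpoly R[i]) : Prop :=
  [/\ forall i, binary_form 1 (L i),
      forall i, divides (L i) (map_mpoly intr F)
    & forall i j, i != j -> ~ proportional (L i) (L j)].

Definition max_num_linear_factors (R : rcfType) (F : binpoly int) (k : nat) :
    Prop :=
  (exists L : 'I_k -> binpoly R[i], nonproportional_factors F L) /\
  (forall (l : nat) (L : 'I_l -> binpoly R[i]),
     nonproportional_factors F L -> (l <= k)%N).

(* The rational constant c is not always absorbed by the linear forms, as in
   2 x^2 y^2. *)
Definition product_of_two_rational_powers (F : binpoly int) : Prop :=
  exists (c : rat) (L M : binpoly rat) (a b : nat),
    [/\ binary_form 1 L, binary_form 1 M, ~ proportional L M,
        (0 < a)%N /\ (0 < b)%N
      & map_mpoly intr F = c *: (L ^+ a * M ^+ b)].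

Definition primitive_solution (F : binpoly int) (m : int) (p : int * int) :
    Prop :=
  gcdz p.1 p.2 = 1 /\ `|bin_eval F p.1 p.2| <= m.

(* A solution up to sign is the set {(x, y), (-x, -y)}. *)
Definition primitive_solutions_up_to_sign (F : binpoly int) (m : int) :
    set (set (int * int)) :=
  [set [set p; (- p.1, - p.2)] | p in primitive_solution F m]%classic.

Definition at_most (R : numDomainType) (T : Type) (A : set T) (B : R) : Prop :=
  exists k : nat, (A #<= `I_k)%card /\ k%:R <= B.

(* Main.v *)
(* Write F = prod L_i with L_i(x, y) = a_i x - b_i y, and measure F in a basis
   E1, E2 of Z^2 by its height M = prod_i max(|L_i(E1)|, |L_i(E2)|).  Hadamard's
   inequality for a homogeneous Vandermonde matrix gives |D| <= n^n M^(2(n-1)),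
   so, with delta = 2(n-1) eps, the hypothesis on m yields
   m (7/2)^(n/2) <= M^(1/2 - delta) in every basis; in particular D <> 0.
   Fix a basis whose M is minimal up to a factor 2.
   Gap principle: completing a solution P with F(P) <> 0 to a basis of Z^2 and
   comparing heights shows that P is very close to some of the roots, and two
   solutions close to the same root have very different sizes.  As the product
   over the roots of the growth factors of P is at least M^(2 delta), and these
   factors multiply to at most M^2 along each root, at most n / delta solutions
   of size at most M^2 are left after removing the largest one for each root.
   Large solutions: F = G H over Z.  A solution of size > M^2 is so close to a
   root, of G say, that a second solution with the same closest root has H(P)
   larger than m, whereas G(P) H(P) <> 0 forces |H(P)| <= m.  A zero Z of F
   at that root is excluded because det(Z, W) divides F(W) for every W, which
   bounds the size of Z; so large solutions and zeros of F together number at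
   most n. *)
Require Import Defs.
From mathcomp Require Import all_boot all_order all_algebra.
From mathcomp Require Import spectral complex.
From mathcomp Require mpoly.
From mathcomp Require Import zify ring lra.
Set Implicit Arguments.
Unset Strict Implicit.
Unset Printing Implicit Defensive.
Import Order.TTheory GRing.Theory Num.Theory.
Local Open Scope ring_scope.

(** * Determinants, rounding, and products over pairs of indices *)

Definition cross (P Q : int * int) : int := P.1 * Q.2 - P.2 * Q.1.

Lemma crossC P Q : cross Q P = - cross P Q.
Proof. rewrite /cross; ring. Qed.

(** Euclidean division, with the quotient moved one step further when the remainder exceeds
    [|v| / 2]. *)
Lemma nearest_int (u v : int) : v != 0 -> exists k : int, 2 * `|u - k * v| <= `|v|.
Proof.
move=> v0; have r0 := modz_ge0 u v0; have r1 := ltz_mod u v0.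
have e := divz_eq u v; set r := (u %% v)%Z in r0 r1 e; set q := (u %/ v)%Z in e.
have [h|h] := leP (2 * r) `|v|.
  by exists q; have -> : u - q * v = r; [rewrite e; ring | rewrite ger0_norm].
exists (q + Num.sg v); have -> : u - (q + Num.sg v) * v = r - `|v|.
  by rewrite normrEsg e; ring.
rewrite ler0_norm; lia.
Qed.

(** Here [(7/2)^n = 2^n * (7/4)^n], [n + 1 <= 2^n] and [(7/4)^3 > 2]. It makes the height exceed
    twice the loss [n + 1] incurred at [test_point]. *)
Lemma lt_exp_7half (R : realFieldType) n :
  (3 <= n)%N -> 2 * n.+1%:R < (7 / 2) ^+ n :> R.
Proof.
move=> n3; have -> : (7 / 2 : R) ^+ n = 2 ^+ n * (7 / 4) ^+ n.
  by rewrite -exprMn; congr (_ ^+ _); field.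
have h1 : n.+1%:R <= 2 ^+ n :> R by rewrite -natrX ler_nat ltn_expl.
have h2 : 2 < (7 / 4) ^+ n :> R.
  apply: (@lt_le_trans _ _ ((7 / 4) ^+ 3)); first by lra.
  by apply: ler_weXn2l => //; lra.
have h3 : 0 < n.+1%:R :> R by rewrite ltr0n.
nra.
Qed.

(** With [A] listed by increasing [h], each factor [g x] is absorbed in passing to the next point,
    so the product telescopes; the last point [e] contributes no factor. *)
Lemma chain_prod_le (R : realFieldType) (T : finType) (h g : T -> R) (A : {set T}) :
  (forall x, x \in A -> 1 <= h x) -> (forall x, x \in A -> 1 <= g x) ->
  {in A &, forall x y, x != y -> h x <= h y -> h x * g x <= h y} ->
  forall x0, x0 \in A -> exists2 e, e \in A &
    (forall x, x \in A -> h x <= h e) /\ \prod_(x in A :\ e) g x <= h e.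
Proof.
have [k] := ubnP #|A|; elim: k A => // k IH A Ak h1 g1 hg x0 x0A.
have [e eA eM] : exists2 e, e \in A & forall x, x \in A -> h x <= h e.
  by case: (@Order.TotalTheory.arg_maxP _ _ _ x0 (mem A) h x0A) => e; exists e.
exists e => //; split=> //.
have [A0|[y yA]] := set_0Vmem (A :\ e).
  by rewrite A0 big_set0 h1.
have sub x : x \in A :\ e -> x \in A by case/setD1P.
have [||||e' e'A [e'M e'P]] := IH (A :\ e) _ _ _ _ y yA.
- by move: Ak; rewrite (cardsD1 e) eA.
- by move=> x /sub; apply: h1.
- by move=> x /sub; apply: g1.
- by move=> x z /sub xA /sub zA; apply: hg.
rewrite (big_setD1 e') //= mulrC.
have e'A' := sub _ e'A.
apply: le_trans (hg _ _ e'A' eA _ (eM _ e'A')); last by case/setD1P: e'A.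
by rewrite ler_wpM2r // (le_trans ler01) ?g1.
Qed.

Lemma prod_offdiag_mul (R : comNzRingType) n (s : 'I_n -> R) :
  \prod_i \prod_(j | j != i) (s i * s j) = (\prod_i s i) ^+ (n.-1).*2.
Proof.
have e : \prod_i \prod_(j | j != i) s i = (\prod_i s i) ^+ n.-1.
  by rewrite -prodrXl; apply: eq_bigr => i _; rewrite prodr_const cardC1 card_ord.
under eq_bigr do rewrite big_split /=.
rewrite big_split /= e -addnn exprD; congr (_ * _).
rewrite (exchange_big_dep predT) //= -e.
by apply: eq_bigr => j _; apply: eq_bigl => i; rewrite eq_sym.
Qed.

Lemma prod_offdiag_sym (R : comNzRingType) n (f : 'I_n -> 'I_n -> R) :
  (forall i j, f i j = f j i) ->
  \prod_i \prod_(j | j != i) f i j 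
  = (\prod_(i < n) \prod_(j < n | (i < j)%N) f i j) ^+ 2.
Proof.
move=> fC; have e (i : 'I_n) : \prod_(j | j != i) f i j =
    \prod_(j < n | (i < j)%N) f i j * \prod_(j < n | (j < i)%N) f i j.
  rewrite (bigID (fun j : 'I_n => (i < j)%N)) /=.
  by congr (_ * _); apply: eq_bigl => j; rewrite -val_eqE /=; case: ltngtP.
rewrite (eq_bigr _ (fun i _ => e i)) big_split /= expr2; congr (_ * _).
rewrite (exchange_big_dep predT) //=; apply: eq_bigr => j _.
by apply: eq_bigr => i _; apply: fC.
Qed.

(** * Linear forms and heights in a basis of Z^2 *)

Section LinearForms.
Variables (R : realFieldType) (K : fieldType) (N : K -> R).
Hypothesis N_ge0 : forall x, 0 <= N x.
Hypothesis N_eq0 : forall x, N x = 0 -> x = 0.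
Hypothesis NM : forall x y, N (x * y) = N x * N y.
Hypothesis NB : forall x y, N (x - y) <= N x + N y.
Hypothesis Nint : forall z : int, N z%:~R = `|z|%:~R.

Variables (n : nat) (a b : 'I_n -> K).

Definition lin (i : 'I_n) (P : int * int) : K :=
  a i * P.1%:~R - b i * P.2%:~R.

Definition wedge (i j : 'I_n) : K := a i * b j - a j * b i.

(** Cramer's rule: [cross P Q * E = cross E Q * P - cross E P * Q]. *)
Lemma lin_cross i E P Q :
  lin i E * (cross P Q)%:~R
  = lin i P * (cross E Q)%:~R - lin i Q * (cross E P)%:~R.
Proof. rewrite /lin /cross !rmorphB !rmorphM /=; ring. Qed.

Lemma wedge_cross i j P Q :
  wedge i j * (cross P Q)%:~R = lin i Q * lin j P - lin i P * lin j Q.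
Proof. rewrite /wedge /lin /cross !rmorphB !rmorphM /=; ring. Qed.

Variables E1 E2 : int * int.
Hypothesis E12 : cross E1 E2 = 1.

(* E1, E2 is a basis of Z^2, and hgt P is the sup norm of P in this basis. *)
Definition hgt (P : int * int) : R :=
  Num.max `|cross P E1|%:~R `|cross P E2|%:~R.
Definition sz (i : 'I_n) : R := Num.max (N (lin i E1)) (N (lin i E2)).

Lemma abs0 : N 0 = 0.
Proof. by rewrite -[0 in LHS]/(0%:~R) Nint normr0. Qed.

Lemma hgt_ge0 P : 0 <= hgt P.
Proof. by rewrite le_max ler0z normr_ge0. Qed.

Lemma sz_ge0 i : 0 <= sz i.
Proof. by rewrite le_max N_ge0. Qed.

(** This is [lin_cross] at the basis vector attaining [sz i]. When [cross P Q] is nonzero, it keeps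
    [P] and [Q] from both being very close to root [i]. *)
Lemma cross_le i P Q :
  `|cross P Q|%:~R * sz i <= hgt P * N (lin i Q) + hgt Q * N (lin i P).
Proof.
have aux E : E = E1 \/ E = E2 ->
    `|cross P Q|%:~R * N (lin i E) <= hgt P * N (lin i Q) + hgt Q * N (lin i P).
  move=> hE; rewrite -Nint mulrC -NM lin_cross.
  apply: (le_trans (NB _ _)); rewrite !NM !Nint addrC.
  apply: lerD; rewrite mulrC ler_wpM2r // crossC normrN /hgt;
  by case: hE => ->; rewrite le_max lexx ?orbT.
rewrite /sz; case: (leP (N (lin i E1)) (N (lin i E2))) => _;
  by apply: aux; auto.
Qed.

(** Dual to [cross_le]: a point cannot be very close to two well separated roots. *)
Lemma wedge_hgt_le i j P :
  N (wedge i j) * hgt P <= sz i * N (lin j P) + sz j * N (lin i P).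
Proof.
have aux E : E = E1 \/ E = E2 ->
    N (wedge i j) * `|cross P E|%:~R <= sz i * N (lin j P) + sz j * N (lin i P).
  move=> hE; rewrite -Nint -NM wedge_cross.
  apply: (le_trans (NB _ _)); rewrite !NM [N (lin i P) * _]mulrC.
  apply: lerD; apply: ler_wpM2r => //; 
  by case: hE => ->; rewrite /sz le_max lexx ?orbT.
rewrite /hgt; case: (leP `|cross P E1|%:~R `|cross P E2|%:~R) => _;
  by apply: aux; auto.
Qed.

Lemma wedge_le i j : N (wedge i j) <= 2 * (sz i * sz j).
Proof.
have -> : N (wedge i j) = N (wedge i j * (cross E1 E2)%:~R).
  by rewrite E12 mulr1.
rewrite wedge_cross; apply: (le_trans (NB _ _)); rewrite !NM mulr2n mulrDl mul1r.
by apply: lerD; apply: ler_pM; rewrite // /sz le_max lexx ?orbT.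
Qed.

Lemma wedgeC i j : N (wedge j i) = N (wedge i j).
Proof.
have -> : wedge j i = wedge i j * (-1)%:~R by rewrite /wedge; ring.
by rewrite NM Nint mulr1.
Qed.

Lemma hgt_ge1 P : P != 0 -> 1 <= hgt P.
Proof.
move=> P0; rewrite le_max; apply/orP.
have hz (z : int) : z != 0 -> 1 <= `|z|%:~R :> R.
  by move=> z0; rewrite -[1]/(1%:~R) ler_int -gtz0_ge1 normr_gt0.
have [c1|] := eqVneq (cross P E1) 0; last by left; apply: hz.
have [c2|] := eqVneq (cross P E2) 0; last by right; apply: hz.
case/negP: P0; apply/eqP; case: P c1 c2 => x y; rewrite /cross /= => c1 c2.
move: E12; rewrite /cross => e12.
congr pair.
  have -> : x = x * (E1.1 * E2.2 - E1.2 * E2.1) by rewrite e12 mulr1.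
  have -> : x * (E1.1 * E2.2 - E1.2 * E2.1) =
     E1.1 * (x * E2.2 - y * E2.1) - E2.1 * (x * E1.2 - y * E1.1) by ring.
  by rewrite c1 c2 !mulr0 subr0.
have -> : y = y * (E1.1 * E2.2 - E1.2 * E2.1) by rewrite e12 mulr1.
have -> : y * (E1.1 * E2.2 - E1.2 * E2.1) =
   E1.2 * (x * E2.2 - y * E2.1) - E2.2 * (x * E1.2 - y * E1.1) by ring.
by rewrite c1 c2 !mulr0 subr0.
Qed.

(** * Normalised distances between points and roots *)

Hypothesis n_gt1 : (1 < n)%N.
Hypothesis wedge_neq0 : forall i j, i != j -> wedge i j != 0.

Lemma sz_gt0 i : 0 < sz i.
Proof.
rewrite lt_def sz_ge0 andbT; apply/eqP => s0.
have [j ij] : exists j : 'I_n, i != j.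
  have [e|ne] := eqVneq i (Ordinal (ltnW n_gt1)); last by eexists; exact: ne.
  by exists (Ordinal n_gt1); rewrite e.
have := wedge_le i j; rewrite s0 mul0r mulr0 => h.
by case/negP: (wedge_neq0 ij); apply/eqP/N_eq0/le_anti; rewrite h N_ge0.
Qed.

(** In the sup norms of the basis, [ell i P / hgt P] and [sep i j] act as projective distances, from
    [P] to root [i] and between roots [i] and [j]. *)
Definition ell i P := N (lin i P) / sz i.
Definition sep i j := N (wedge i j) / (sz i * sz j).
Definition height := \prod_i sz i.

Lemma ell_ge0 i P : 0 <= ell i P.
Proof. by rewrite divr_ge0 ?sz_ge0. Qed.

Lemma cross_le_ell i P Q :
  `|cross P Q|%:~R <= hgt P * ell i Q + hgt Q * ell i P.
Proof.
rewrite /ell !mulrA -mulrDl ler_pdivlMr ?sz_gt0 //; exact: cross_le.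
Qed.

Lemma sep_hgt_le i j P : sep i j * hgt P <= ell j P + ell i P.
Proof.
have si := sz_gt0 i; have sj := sz_gt0 j.
have -> : ell j P + ell i P =
   (sz i * N (lin j P) + sz j * N (lin i P)) / (sz i * sz j).
  by rewrite /ell; field; rewrite !gt_eqF.
by rewrite /sep mulrAC ler_pM2r ?invr_gt0 ?mulr_gt0 // wedge_hgt_le.
Qed.

Lemma sep_ge0 i j : 0 <= sep i j.
Proof. by rewrite divr_ge0 ?mulr_ge0 ?sz_ge0. Qed.

Lemma sep_le2 i j : sep i j <= 2.
Proof. by rewrite ler_pdivrMr ?mulr_gt0 ?sz_gt0 // wedge_le. Qed.

Lemma sepC i j : sep i j = sep j i.
Proof. by rewrite /sep wedgeC [sz i * _]mulrC. Qed.

Lemma height_gt0 : 0 < height.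
Proof. by apply: prodr_gt0 => i _; apply: sz_gt0. Qed.

(** Each pair of roots occurs in both orders, which replaces the squares in D: this is [|D|]. *)
Definition disc := \prod_i \prod_(j | j != i) N (wedge i j).

Lemma prod_sep :
  \prod_i \prod_(j | j != i) sep i j = disc / height ^+ (n.-1).*2.
Proof.
rewrite /disc -prod_offdiag_mul -prodfV -big_split /=; apply: eq_bigr => i _.
by rewrite -prodfV -big_split.
Qed.

(** The factors involving [i0] occur twice by symmetry; each of the [(n-1)(n-2)] others is at most
    2. *)
Lemma prod_sep_le i0 :
  disc / height ^+ (n.-1).*2
  <= (\prod_(j | j != i0) sep i0 j) ^+ 2 * (2 ^+ n.-2) ^+ n.-1.
Proof.
rewrite -prod_sep (bigD1 i0) //= expr2 -mulrA ler_wpM2l ?prodr_ge0 //.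
  by move=> j _; apply: sep_ge0.
have -> : (2 ^+ n.-2) ^+ n.-1 = \prod_(j | j != i0) (2 ^+ n.-2 : R).
  by rewrite prodr_const cardC1 card_ord.
rewrite -big_split /=; apply: ler_prod => i ii0; apply/andP; split.
  by apply: prodr_ge0 => j _; apply: sep_ge0.
rewrite (bigD1 i0) 1?eq_sym //= sepC ler_wpM2l ?sep_ge0 //.
have -> : 2 ^+ n.-2 = \prod_(j | (j != i) && (j != i0)) (2 : R).
  rewrite prodr_const; congr (_ ^+ _).
  have := cardC1 i; rewrite card_ord => <-.
  rewrite [in LHS](cardD1 i0) !inE eq_sym ii0 /=.
  by apply: eq_card => j; rewrite !inE andbC.
by apply: ler_prod => j _; rewrite sep_ge0 sep_le2.
Qed.


(** * Approximation of roots by points where the form is small *)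

Local Notation H := height.
Variable m : R.
Hypothesis m_ge1 : 1 <= m.
Hypothesis n_gt2 : (2 < n)%N.
(** Both bounds come from the upper bound on [m], through [mahler_ge] and [discriminant_ge]. *)
Hypothesis height_ge : (7 / 2) ^+ n * m ^+ 2 <= height.
Hypothesis disc_ge : m ^+ 2 * 2 ^+ (n * n.-1) <= disc.

Lemma m_gt0 : 0 < m.
Proof. exact: lt_le_trans m_ge1. Qed.

Definition fval P := \prod_i N (lin i P).

Lemma height_pow : H ^+ n.-1 = H * H ^+ n.-2.
Proof. by rewrite -exprS; case: (n) n_gt2 => [|[]]. Qed.

Lemma height_gt : 2 * n.+1%:R < H.
Proof.
apply: lt_le_trans height_ge; apply: (lt_le_trans (lt_exp_7half _ n_gt2)).
by rewrite ler_peMr ?exprn_ge0 ?exprn_ege1 //; lra.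
Qed.

Lemma height_gt2 : 2 < H.
Proof.
apply: le_lt_trans height_gt.
have : 1 <= n.+1%:R :> R by rewrite ler1n.
lra.
Qed.

(** Square root of [prod_sep_le] combined with [disc_ge]; the powers of 2 match because
    [2(n-1) + (n-2)(n-1) = n(n-1)]. *)
Lemma root_sep i : m * 2 ^+ n.-1 / H ^+ n.-1 <= \prod_(j | j != i) sep i j.
Proof.
have h0 := height_gt0; have r0 : 0 <= \prod_(j | j != i) sep i j.
  by apply: prodr_ge0 => j _; apply: sep_ge0.
have p0 k : 0 < (2 : R) ^+ k by apply: exprn_gt0.
rewrite -(@ler_pXn2r _ 2) ?nnegrE //; last first.
  by rewrite divr_ge0 ?exprn_ge0 ?mulr_ge0 ?exprn_ge0 ?(ltW h0) // ltW ?m_gt0.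
rewrite -(ler_pM2r (p0 (n.-2 * n.-1)%N)).
have := prod_sep_le i; rewrite -exprM; apply: le_trans.
rewrite expr_div_n -exprM muln2 mulrAC ler_pM2r ?invr_gt0 ?exprn_gt0 //.
apply: le_trans disc_ge; rewrite exprMn -mulrA -exprM -exprD.
suff -> : (n.-1 * 2 + n.-2 * n.-1 = n * n.-1)%N by [].
by case: (n) n_gt2 => [|[|k]] //= _; rewrite mulnC -mulnDl.
Qed.

Lemma fvalE i P : fval P = H * (ell i P * \prod_(j | j != i) ell j P).
Proof.
have -> : ell i P * \prod_(j | j != i) ell j P = \prod_j ell j P.
  by rewrite [RHS](bigD1 i).
rewrite /fval -big_split /=; apply: eq_bigr => j _.
by rewrite /ell mulrC divfK // gt_eqF ?sz_gt0.
Qed.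

Lemma prod_closest i P : (forall j, ell i P <= ell j P) ->
  forall A : {pred 'I_n}, (forall j, j \in A -> j != i) ->
  \prod_(j in A) (sep i j * (hgt P / 2)) <= \prod_(j in A) ell j P.
Proof.
move=> cl A Ai; apply: ler_prod => j _; apply/andP; split.
  by rewrite mulr_ge0 ?sep_ge0 ?divr_ge0 ?hgt_ge0.
have := sep_hgt_le i j P; have := cl j; lra.
Qed.

(* A Lewis-Mahler type estimate: if i is the root closest to P, then
   ell j P >= sep i j * hgt P / 2 for every j, and the product of the sep i j is
   bounded below by the discriminant. *)
Lemma closest_small i P : (forall j, ell i P <= ell j P) -> fval P <= m ->
  ell i P * hgt P ^+ n.-1 <= H ^+ n.-2.
Proof.
move=> cl Fm; have h0 := height_gt0.
have l0 := ell_ge0 i P.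
have := @prod_closest i P cl (predC1 i) (fun j => id).
rewrite big_split /= prodr_const cardC1 card_ord exprMn exprVn => h1.
have h2 := root_sep i; have g0 : 0 <= hgt P ^+ n.-1 by rewrite exprn_ge0 ?hgt_ge0.
have p0 : 0 < (2 : R) ^+ n.-1 by apply: exprn_gt0.
move: Fm h1; rewrite (fvalE i).
set r := \prod_(j | _) sep i j in h2 *; set e := \prod_(j | _) ell j P.
move=> Fm h1.
have {}h2 : m * (hgt P ^+ n.-1 / H ^+ n.-1) <= e.
  apply: le_trans h1; rewrite [X in _ <= X]mulrA ler_pdivlMr //.
  apply: le_trans (ler_wpM2r g0 h2); rewrite le_eqVlt; apply/orP; left; apply/eqP; ring.
have m0 := m_gt0.
have : H * (ell i P * (m * (hgt P ^+ n.-1 / H ^+ n.-1))) <= m.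
  by apply: le_trans Fm; rewrite ler_pM2l // ler_wpM2l.
have -> : H * (ell i P * (m * (hgt P ^+ n.-1 / H ^+ n.-1))) =
   m * ((ell i P * hgt P ^+ n.-1) / H ^+ n.-2).
  by rewrite height_pow; field; rewrite ?gt_eqF ?exprn_gt0.
by rewrite -ler_pdivlMl // mulVf ?gt_eqF // ler_pdivrMr ?exprn_gt0 // mul1r.
Qed.

(** Pigeonhole over [E1 + k E2], [0 <= k <= n]: each [L_i] vanishes at no more than one of these
    [n + 1] points. *)
Lemma test_point : exists W, [/\ cross W E2 = 1,
  forall i, N (lin i W) <= n.+1%:R * sz i & forall i, lin i W != 0].
Proof.
pose W (k : nat) : int * int := (E1.1 + k%:Z * E2.1, E1.2 + k%:Z * E2.2).
have linW i k : lin i (W k) = lin i E1 - lin i E2 * (- k%:Z)%:~R.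
  by rewrite /lin /= !rmorphD !rmorphM rmorphN /=; ring.
have [k /forallP Wk] : exists k : 'I_n.+1, [forall i, lin i (W k) != 0].
  apply/existsP; apply: contraT; rewrite negb_exists => /forallP h.
  have h' (k : 'I_n.+1) : exists i, lin i (W k) == 0.
    by have := h k; rewrite negb_forall => /existsP [j]; rewrite negbK; exists j.
  pose f k := xchoose (h' k).
  have fP k : lin (f k) (W k) = 0 by apply/eqP/(xchooseP (h' k)).
  have : injective f.
    move=> k l fkl; have := fP k; have := fP l; rewrite -fkl !linW => el ek.
    have : lin (f k) E2 * (k%:Z - l%:Z)%:~R = 0.
      rewrite -[RHS](subrr 0) -{1}ek -el !rmorphN rmorphB /=; ring.
    move/eqP; rewrite mulf_eq0 => /orP [/eqP e2|].
      have e1 : lin (f k) E1 = 0 by move: ek; rewrite e2 mul0r subr0.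
      by have := sz_gt0 (f k); rewrite /sz e1 e2 maxxx abs0 ltxx.
    move/eqP => e; apply/val_inj/eqP => /=.
    have : N (k%:Z - l%:Z)%:~R = 0 by rewrite e abs0.
    rewrite Nint => /eqP; rewrite intr_eq0 normr_eq0 subr_eq0 => /eqP [->].
    by rewrite eqxx.
  by move/leq_card; rewrite !card_ord ltnn.
exists (W k); split=> // [|i]; first by rewrite -E12 /cross /=; ring.
rewrite linW; apply: (le_trans (NB _ _)).
rewrite NM Nint normrN.
have -> : `|k%:Z|%:~R = k%:R :> R by [].
have k_le : k%:R <= n%:R :> R by rewrite ler_nat -ltnS.
have s1 : N (lin i E1) <= sz i by rewrite /sz le_max lexx.
have s2 : N (lin i E2) <= sz i by rewrite /sz le_max lexx orbT.
have := ler_pM (N_ge0 _) (ler0n _ _) s2 k_le.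
rewrite -natr1; lra.
Qed.

(** * Zeros of the form and large solutions *)

Hypothesis zero_dvd : forall i Z W, gcdz Z.1 Z.2 = 1 -> lin i Z = 0 ->
  fval W != 0 -> `|cross Z W|%:~R <= fval W.

(** For the test point [W], [L_i(Z) = 0] gives [|L_i(W)| * hgt Z <= sz i * |cross Z W|], where
    [|cross Z W| <= fval W]. Cancelling [|L_i(W)|] leaves the factors [j != i], each at most
    [(n+1) * sz j]. *)
Lemma zero_hgt_le i Z : gcdz Z.1 Z.2 = 1 -> lin i Z = 0 ->
  hgt Z <= n.+1%:R ^+ n.-1 * H.
Proof.
move=> gZ lZ; have [W [_ W1 W0]] := test_point.
have NW j : 0 < N (lin j W).
  by rewrite lt_def N_ge0 andbT; apply/eqP => /N_eq0 /eqP; apply/negP/W0.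
have fW : fval W != 0 by apply/prodf_neq0 => j _; rewrite gt_eqF.
have := zero_dvd gZ lZ fW; rewrite /fval (bigD1 i) //= => h1.
have h2 : N (lin i W) * hgt Z <= sz i * `|cross Z W|%:~R.
  have aux E : E = E1 \/ E = E2 -> N (lin i W) * `|cross Z E|%:~R
      <= sz i * `|cross Z W|%:~R.
    move=> hE; have := lin_cross i E Z W; rewrite lZ mul0r sub0r => e.
    have -> : N (lin i W) * `|cross Z E|%:~R = N (lin i E) * `|cross Z W|%:~R.
      rewrite -!Nint -!NM e -[in RHS]mulrN -rmorphN /=; congr (N (_ * _%:~R)).
      by rewrite crossC.
    apply: ler_wpM2r; first by rewrite ler0z.
    by case: hE => ->; rewrite /sz le_max lexx ?orbT.
  by rewrite /hgt; case: (leP `|cross Z E1|%:~R `|cross Z E2|%:~R) => _;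
    apply: aux; auto.
rewrite -(ler_pM2l (NW i)); apply: (le_trans h2).
apply: (le_trans (ler_wpM2l (sz_ge0 i) h1)).
rewrite mulrCA ler_pM2l // [H](bigD1 i) //= mulrCA ler_pM2l ?sz_gt0 //.
have -> : n.+1%:R ^+ n.-1 = \prod_(j | j != i) (n.+1%:R : R).
  by rewrite prodr_const cardC1 card_ord.
by rewrite -big_split /=; apply: ler_prod => j _; rewrite N_ge0 W1.
Qed.

(** Insert [hgt P > H^2] in [closest_small]; the exponents fit by [2(n-1) = n + (n-2)]. *)
Lemma big_closest_small i P : (forall j, ell i P <= ell j P) -> fval P <= m ->
  H ^+ 2 < hgt P -> ell i P * H ^+ n <= 1.
Proof.
move=> cl Fm big; have h0 := height_gt0; have := closest_small cl Fm.
have : ell i P * (H ^+ 2) ^+ n.-1 <= ell i P * hgt P ^+ n.-1.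
  by rewrite ler_wpM2l ?ell_ge0 // lerXn2r ?nnegrE ?exprn_ge0 ?hgt_ge0 // ltW.
move=> h1 h2; have := le_trans h1 h2.
have -> : (H ^+ 2) ^+ n.-1 = H ^+ n * H ^+ n.-2.
  by rewrite -exprM -exprD; congr (_ ^+ _); case: (n) n_gt2 => [|[|k]] //=; lia.
by rewrite mulrA -[X in _ <= X]mul1r ler_pM2r ?exprn_gt0.
Qed.

(** Otherwise [1 <= hgt Z * ell i P <= (n+1)^(n-1) * H * H^(-n)], which is below 1 because
    [H > n + 1]. *)
Lemma zero_big_cross_eq0 i Z P : gcdz Z.1 Z.2 = 1 -> lin i Z = 0 ->
  (forall j, ell i P <= ell j P) -> fval P <= m -> H ^+ 2 < hgt P ->
  cross Z P = 0.
Proof.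
move=> gZ lZ cl Fm big; apply/eqP; apply: contraT => c0.
have h0 := height_gt0.
have h1 : 1 <= hgt Z * ell i P.
  have := cross_le_ell i Z P; rewrite {2}/ell lZ abs0 mul0r mulr0 addr0.
  by apply: le_trans; rewrite -[1]/(1%:~R) ler_int -gtz0_ge1 normr_gt0.
have := zero_hgt_le gZ lZ; have := big_closest_small cl Fm big.
have -> : H ^+ n = H * H ^+ n.-1 by rewrite -exprS; case: (n) n_gt2.
move=> h2 h3.
have := le_trans h1 (ler_wpM2r (ell_ge0 i P) h3); rewrite -mulrA => h4.
suff /(le_lt_trans h4) : n.+1%:R ^+ n.-1 * (H * ell i P) < 1 by rewrite ltxx.
have hl : 0 < H * ell i P.
  rewrite lt_def mulr_ge0 ?ell_ge0 ?ltW // andbT; apply/eqP => e.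
  by move: h4; rewrite e mulr0 ler10.
apply: (@lt_le_trans _ _ (H ^+ n.-1 * (H * ell i P))); last first.
  by apply: le_trans h2; rewrite le_eqVlt; apply/orP; left; apply/eqP; ring.
rewrite ltr_pM2r // ltrXn2r ?nnegrE ?ler0n ?ltW //; first by case: (n) n_gt2 => [|[]].
by have := height_gt; have : 0 < n.+1%:R :> R by []; lra.
Qed.

(** In [1 <= hgt P * ell i Q + hgt Q * ell i P] the first term is at most [1/2], by [closest_small]
    for [Q], and the second at most [hgt Q * H^(-n)]. *)
Lemma big_closest_hgt_ge i P Q : (forall j, ell i P <= ell j P) ->
  (forall j, ell i Q <= ell j Q) -> fval P <= m -> fval Q <= m ->
  H ^+ 2 < hgt P -> hgt P <= hgt Q -> cross P Q != 0 -> H ^+ n <= 2 * hgt Q.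
Proof.
move=> clP clQ FP FQ big PQ c0; have h0 := height_gt0; have h2 := height_gt2.
have bigQ := lt_le_trans big PQ.
have q0 : 0 < hgt Q by apply: lt_trans bigQ; apply: exprn_gt0.
have h1 : 1 <= hgt P * ell i Q + hgt Q * ell i P.
  have := cross_le_ell i P Q.
  by apply: le_trans; rewrite -[1]/(1%:~R) ler_int -gtz0_ge1 normr_gt0.
have h3 : 2 * (hgt Q * ell i Q) <= 1.
  have := closest_small clQ FQ.
  have -> : hgt Q ^+ n.-1 = hgt Q * hgt Q ^+ n.-2.
    by rewrite -exprS; case: (n) n_gt2 => [|[]].
  have e : 2 * H ^+ n.-2 <= hgt Q ^+ n.-2.
    apply: (@le_trans _ _ ((2 * H) ^+ n.-2)).
      rewrite exprMn ler_pM2r ?exprn_gt0 // -[X in X <= _]expr1.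
      by apply: ler_weXn2l; [lra | case: (n) n_gt2 => [|[|[]]]].
    rewrite lerXn2r ?nnegrE ?mulr_ge0 ?ltW //.
    by apply: lt_trans bigQ; rewrite expr2; nra.
  have p0 : 0 < H ^+ n.-2 by apply: exprn_gt0.
  have l0 := mulr_ge0 (ltW q0) (ell_ge0 i Q) => e2.
  have := ler_wpM2l l0 e; rewrite -(ler_pM2r p0) => e3; nra.
have h4 : hgt P * ell i Q <= hgt Q * ell i Q by rewrite ler_wpM2r ?ell_ge0.
have h5 : 1 <= 2 * (hgt Q * ell i P) by lra.
have h6 := big_closest_small clP FP big.
have p0 : 0 <= H ^+ n by rewrite exprn_ge0 // ltW.
have := ler_wpM2r p0 h5; nra.
Qed.

(* Satisfied by the absolute values of an integral form proportional to the
   product of the L_i with i in A. *)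
Definition discrete (A : {set 'I_n}) (c : R) := forall P,
  c * \prod_(i in A) N (lin i P) != 0 -> 1 <= c * \prod_(i in A) N (lin i P).

(** The factor of the form with roots in [A], among them the root [i] closest to [Q], is at least 1
    at [Q], so the complementary factor is at most [m]. The roots of the latter are separated from
    [i], and a very large [Q] would make it exceed [m]. *)
Lemma closest_hgt_lt (A : {set 'I_n}) (c c' : R) i j Q : c * c' = 1 -> 0 < c -> 0 < c' ->
  i \in A -> j \notin A -> discrete A c -> discrete (~: A) c' ->
  (forall j, ell i Q <= ell j Q) -> fval Q <= m -> fval Q != 0 ->
  2 * hgt Q < H ^+ n.
Proof.
move=> cc c_gt0 c'_gt0 iA jA dA dB cl Fm F0; rewrite ltNge; apply/negP => hQ.
have h0 := height_gt0; have nn0 : 0 < n.+1%:R :> R by [].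
have [W [_ W1 W0]] := test_point.
have Wp : 0 < c' * \prod_(i in ~: A) N (lin i W).
  apply: mulr_gt0 => //; apply: prodr_gt0 => k _.
  by rewrite lt_def N_ge0 andbT; apply/eqP => /N_eq0 /eqP; apply/negP/W0.
have h1 : 1 <= c' * \prod_(i in ~: A) (n.+1%:R * sz i).
  apply: le_trans (dB W _) _; first by rewrite gt_eqF.
  by rewrite ler_pM2l //; apply: ler_prod => k _; rewrite N_ge0 W1.
have FE : fval Q = (c * \prod_(i in A) N (lin i Q)) *
                   (c' * \prod_(i in ~: A) N (lin i Q)).
  rewrite mulrACA cc mul1r /fval (bigID (mem A)) /=; congr (_ * _).
  by apply: eq_bigl => k; rewrite !inE.
have h2 : c' * \prod_(i in ~: A) N (lin i Q) <= m.
  apply: le_trans Fm; rewrite FE ler_peMl ?mulr_ge0 ?prodr_ge0 ?(ltW c'_gt0) //.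
  by apply: dA; move: F0; rewrite FE mulf_eq0 negb_or => /andP [].
pose X := hgt Q / (2 * n.+1%:R).
have h3 : \prod_(k in ~: A) (sep i k * X) <= m.
  apply: le_trans h2.
  have -> : c' * \prod_(k in ~: A) N (lin k Q) =
     (c' * \prod_(k in ~: A) (n.+1%:R * sz k)) * \prod_(k in ~: A) (ell k Q / n.+1%:R).
    rewrite -mulrA; congr (_ * _); rewrite -big_split /=; apply: eq_bigr => k _.
    rewrite /ell; move: (n.+1%:R : R) (gt_eqF nn0) => q q0.
    by field; rewrite q0 (gt_eqF (sz_gt0 k)).
  apply: le_trans (ler_peMl _ h1); last first.
    by apply: prodr_ge0 => k _; rewrite divr_ge0 ?ell_ge0.
  apply: ler_prod => k kA; rewrite mulr_ge0 ?sep_ge0 ?divr_ge0 ?hgt_ge0 ?mulr_ge0 //=.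
  rewrite /X invfM !mulrA ler_pM2r ?invr_gt0 //.
  by have := sep_hgt_le i k Q; have := cl k; lra.
have HH : H ^+ n = H * H ^+ n.-1 by rewrite -exprS; case: (n) n_gt2.
have Hn1 : 0 < H ^+ n.-1 by apply: exprn_gt0.
have X1 : H ^+ n <= 4 * n.+1%:R * X.
  apply: le_trans hQ _; rewrite /X le_eqVlt; apply/orP; left; apply/eqP.
  by move: (n.+1%:R : R) (gt_eqF nn0) => q q0; field; rewrite q0.
have X2 : 1 <= X.
  have : 4 * n.+1%:R <= 4 * n.+1%:R * X; last by rewrite ler_pMr ?mulr_gt0.
  apply: le_trans X1; have := height_gt; have := height_gt2.
  have : H * H <= H ^+ n.
    by rewrite -expr2; apply: ler_weXn2l; [have := height_gt2; lra | apply: ltnW].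
  move=> e1 e2 e3; nra.
(* A single power of [X >= 1] is kept; there is one because [j] lies outside [A]. *)
have h4 : X * \prod_(k in ~: A) sep i k <= m.
  apply: le_trans h3; rewrite [X in _ <= X]big_split /= mulrC ler_wpM2l //.
    by apply: prodr_ge0 => k _; apply: sep_ge0.
  rewrite prodr_const -[X in X <= _]expr1; apply: ler_weXn2l => //.
  by apply/card_gt0P; exists j; rewrite inE.
(* Besides [i], the set [A] has at most [n - 2] elements, as it misses [j]; each [sep] there is at
   most 2. *)
have h5 : \prod_(k | k != i) sep i k <= 2 ^+ n.-2 * \prod_(k in ~: A) sep i k.
  rewrite (bigID (mem A)) /=.
  have -> : \prod_(k | (k != i) && (k \notin A)) sep i k = \prod_(k in ~: A) sep i k.
    apply: eq_bigl => k; rewrite !inE; case: eqP => [->|] //=; by rewrite iA.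
  apply: ler_wpM2r; first by apply: prodr_ge0 => k _; apply: sep_ge0.
  apply: (@le_trans _ _ (\prod_(k | (k != i) && (k \in A)) (2 : R))).
    by apply: ler_prod => k _; rewrite sep_ge0 sep_le2.
  rewrite prodr_const; apply: ler_weXn2l; first by lra.
  have := cardC1 i; rewrite card_ord => <-.
  rewrite [X in (_ <= X.-1)%N](cardD1 j) !inE.
  have -> : j != i by apply: contraNneq jA => ->.
  apply: subset_leq_card; apply/subsetP => k; rewrite !inE => /andP [-> kA].
  by rewrite andbT; apply: contraNneq jA => <-.
have h6 := root_sep i; have h7 := le_trans h6 h5.
have h8 : X * (m * 2 ^+ n.-1 / H ^+ n.-1) <= 2 ^+ n.-2 * m.
  apply: le_trans (ler_wpM2l _ h7) _; first by lra.
  by rewrite mulrCA ler_pM2l ?exprn_gt0.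
have p0 : 0 < (2 : R) ^+ n.-2 by apply: exprn_gt0.
have p2 : (2 : R) ^+ n.-1 = 2 * 2 ^+ n.-2 by rewrite -exprS; case: (n) n_gt2 => [|[]].
have h9 : X * 2 <= H ^+ n.-1.
  have m0 := m_gt0.
  have e : X * (m * 2 ^+ n.-1 / H ^+ n.-1) = 2 ^+ n.-2 * m * (X * 2 / H ^+ n.-1).
    by rewrite p2; field; rewrite gt_eqF.
  move: h8; rewrite e -[X in _ <= X]mulr1 ler_pM2l ?mulr_gt0 //.
  by rewrite ler_pdivrMr // mul1r.
have := height_gt; move: X1; rewrite HH => X1 e.
have : H * H ^+ n.-1 <= 2 * n.+1%:R * H ^+ n.-1 by nra.
by rewrite ler_pM2r // leNgt e.
Qed.


(** * The gap principle in a nearly reduced basis *)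

Hypothesis reduced : forall P P', cross P P' = 1 ->
  H <= 2 * \prod_i Num.max (N (lin i P)) (N (lin i P')).

(* Equal to 1 unless 2 * hgt P * ell i P < 1, and also (as 0^-1 = 0) when P is
   a zero of L_i. *)
Definition grow i P := Num.max 1 (2 * hgt P * ell i P)^-1.

Lemma grow_ge1 i P : 1 <= grow i P.
Proof. by rewrite le_max lexx. Qed.

(* Complete P to a basis P, P'' of Z^2 where P'' is chosen modulo P so that E1
   or E2 has a small coordinate along P. *)
Lemma height_le_prod_grow P : gcdz P.1 P.2 = 1 -> fval P != 0 -> fval P <= m ->
  H <= 2 * m * (5 / 2) ^+ n * \prod_i grow i P.
Proof.
move=> gP F0 Fm.
have Np i : 0 < N (lin i P).
  by rewrite lt_def N_ge0 andbT; move/prodf_neq0: F0; apply.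
have [E hE EP] : exists2 E, E = E1 \/ E = E2 & `|cross P E|%:~R = hgt P.
  by rewrite /hgt; case: (leP `|cross P E1|%:~R `|cross P E2|%:~R) => _;
    [exists E2 | exists E1]; auto.
have P0 : P != 0.
  by apply/eqP => e; move: gP; rewrite e gcdz0.
have h1 := hgt_ge1 P0; have h0 : 0 < hgt P by apply: lt_le_trans h1.
have v0 : cross P E != 0.
  by apply/eqP => e; move: h0; rewrite -EP e normr0 ltxx.
have [u [v uv]] : exists u v : int, u * P.1 + v * P.2 = 1.
  by case: (Bezoutz P.1 P.2) => u [v e]; exists u, v; rewrite e gP.
pose P' : int * int := (- v, u).
have c1 : cross P P' = 1 by rewrite /cross /= -uv; ring.
have [k hk] := nearest_int (cross E P') v0.
pose P'' : int * int := (P'.1 + k * P.1, P'.2 + k * P.2).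
have c2 : cross P P'' = 1 by rewrite -c1 /cross /=; ring.
apply: (le_trans (reduced c2)); rewrite -!mulrA ler_pM2l //.
apply: (@le_trans _ _ (\prod_i (N (lin i P) * (5 / 2 * grow i P)))); last first.
  rewrite big_split /= ler_pM ?prodr_ge0 //.
    by move=> i _; rewrite mulr_ge0 // ?(le_trans ler01) ?grow_ge1 //; lra.
  by rewrite big_split /= prodr_const card_ord.
apply: ler_prod => i _; rewrite le_max N_ge0 /=.
(* This is [cross P E * P'' = E - cross E P'' * P], where [|cross E P''| <= hgt P / 2] by the choice
   of [k]. *)
have lE : lin i P'' * (cross P E)%:~R
    = lin i E - lin i P * (cross E P' - k * cross P E)%:~R.
  have -> : lin i E = lin i E * (cross P P')%:~R by rewrite c1 mulr1.
  by rewrite /lin /cross !(rmorphB, rmorphM, rmorphD, rmorphN) /=; ring.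
have sE : N (lin i E) <= sz i by case: hE => ->; rewrite /sz le_max lexx ?orbT.
have h2 : N (lin i P'') * hgt P <= sz i + N (lin i P) * (hgt P / 2).
  rewrite -EP -Nint -NM lE; apply: (le_trans (NB _ _)); apply: lerD => //.
  rewrite NM ler_pM2l // Nint.
  have : (2 * `|cross E P' - k * cross P E|)%:~R <= `|cross P E|%:~R :> R.
    by rewrite ler_int.
  by rewrite Nint rmorphM /=; lra.
have g1 := grow_ge1 i P.
rewrite ge_max; apply/andP; split.
  by rewrite ler_peMr //; lra.
rewrite -(ler_pM2r h0); apply: (le_trans h2).
have g2 : (2 * hgt P * ell i P)^-1 <= grow i P by rewrite /grow le_max lexx orbT.
(* The constant [5/2] is [2 + 1/2]: the term [sz i] costs [2 * grow i P], the rounding term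
   [1/2]. *)
have -> : sz i = 2 * (2 * hgt P * ell i P)^-1 * N (lin i P) * hgt P.
  by rewrite /ell; field; rewrite !gt_eqF ?sz_gt0 ?h0 ?Np.
have := mulr_gt0 (Np i) h0; nra.
Qed.

(** Growth above 1 at [Q] means [hgt Q * ell i Q < 1/2], so [cross_le_ell] forces
    [hgt Q * ell i P > 1/2], while [hgt P * grow i P = 1 / (2 * ell i P)]. *)
Lemma grow_chain i P Q : cross P Q != 0 -> hgt P <= hgt Q ->
  1 < grow i P -> 1 < grow i Q -> hgt P * grow i P <= hgt Q.
Proof.
move=> c0 PQ; rewrite /grow !lt_max ltxx /=.
have lP := ell_ge0 i P; have lQ := ell_ge0 i Q.
have hP := hgt_ge0 P; have hQ := hgt_ge0 Q.
have h1 : 1 <= hgt P * ell i Q + hgt Q * ell i P.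
  have := cross_le_ell i P Q.
  by apply: le_trans; rewrite -[1]/(1%:~R) ler_int -gtz0_ge1 normr_gt0.
move=> gP gQ; rewrite (max_r (ltW gP)).
have [x0|x0] := boolP (0 < 2 * hgt P * ell i P); last first.
  move: gP; rewrite ltNge (le_trans _ ler01) // invr_le0.
  by rewrite leNgt.
have [y0|y0] := boolP (0 < 2 * hgt Q * ell i Q); last first.
  move: gQ; rewrite ltNge (le_trans _ ler01) // invr_le0.
  by rewrite leNgt.
move: gP gQ; rewrite !invf_gt1 // => gP gQ.
have hP0 : 0 < hgt P.
  by rewrite lt_def hP andbT; apply: contraTneq x0 => ->; rewrite mulr0 mul0r ltxx.
have lP0 : 0 < ell i P.
  by rewrite lt_def lP andbT; apply: contraTneq x0 => ->; rewrite mulr0 ltxx.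
have -> : hgt P * (2 * hgt P * ell i P)^-1 = (2 * ell i P)^-1.
  by field; rewrite !gt_eqF.
rewrite -[X in X <= _]mul1r ler_pdivrMr; last exact: mulr_gt0.
have := ler_wpM2r lQ PQ; lra.
Qed.

(** * Counting pairwise non-proportional primitive solutions *)

Variables (A : {set 'I_n}) (cA cB : R).
Hypotheses (cAB : cA * cB = 1) (cA_gt0 : 0 < cA) (cB_gt0 : 0 < cB).
Hypotheses (A_neq0 : A != set0) (A_neqT : ~: A != set0).
Hypotheses (discA : discrete A cA) (discB : discrete (~: A) cB).

Variables (k : nat) (p : 'I_k -> int * int).
Hypothesis p_prim : forall t, gcdz (p t).1 (p t).2 = 1.
Hypothesis p_sol : forall t, fval (p t) <= m.
Hypothesis p_cross : forall s t, s != t -> cross (p s) (p t) != 0.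

(** The bounds [big_closest_hgt_ge] and [closest_hgt_lt] contradict each other; [A] and its
    complement swap roles when [i] lies outside [A]. *)
Lemma big_closest_cross_eq0 i P Q : fval P <= m -> fval Q <= m -> fval Q != 0 ->
  (forall j, ell i P <= ell j P) -> (forall j, ell i Q <= ell j Q) ->
  H ^+ 2 < hgt P -> hgt P <= hgt Q -> cross P Q = 0.
Proof.
move=> FP FQ Q0 clP clQ big PQ; apply/eqP; apply: contraT => c0.
have := big_closest_hgt_ge clP clQ FP FQ big PQ c0; rewrite leNgt => /negP; case.
have [iA|iA] := boolP (i \in A).
  have [j jA] := set0Pn _ A_neqT.
  apply: (closest_hgt_lt cAB _ _ iA _ discA discB) => //; move: jA; rewrite inE; exact.
have [j jA] := set0Pn _ A_neq0.
have iA' : i \in ~: A by rewrite inE.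
apply: (closest_hgt_lt (j := j) _ cB_gt0 cA_gt0 iA' _ discB) => //.
- by rewrite mulrC.
- by rewrite inE negbK.
- by rewrite setCK.
Qed.

Definition exceptional : {set 'I_k} :=
  [set t | (fval (p t) == 0) || (H ^+ 2 < hgt (p t))].

(** Sending a point to a closest root is injective here: two points with the same root would have
    determinant 0, be they two zeros, a zero and a large solution, or two large solutions. *)
Lemma card_exceptional : (#|exceptional| <= n)%N.
Proof.
have cl P : exists i, [forall j, ell i P <= ell j P].
  have i0 : 'I_n by case: (n) n_gt2 => // q _; exact: ord0.
  by case: (@Order.TotalTheory.arg_minP _ _ _ i0 predT (ell^~ P) isT) => i _ h;
    exists i; apply/forallP => j; apply: h.
pose f t := xchoose (cl (p t)).
have fP t j : ell (f t) (p t) <= ell j (p t).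
  by move/forallP: (xchooseP (cl (p t))); apply.
have zP t : fval (p t) == 0 -> lin (f t) (p t) = 0.
  move=> /prodf_eq0 [j _ /eqP e]; apply: N_eq0; apply/eqP.
  have := fP t j; rewrite {2}/ell e mul0r => h.
  have : ell (f t) (p t) == 0 by rewrite eq_le h ell_ge0.
  by rewrite mulf_eq0 invr_eq0 (gt_eqF (sz_gt0 _)) orbF.
suff inj : {in exceptional &, injective f}.
  by rewrite -(card_in_imset inj) -[X in (_ <= X)%N]card_ord max_card.
move=> s t; rewrite !inE => hs ht fst; apply/eqP; apply: contraT => st.
have c0 := p_cross st; have c0' : cross (p t) (p s) != 0 by rewrite crossC oppr_eq0.
have fPs j : ell (f t) (p s) <= ell j (p s) by rewrite -fst.
have [/eqP zs|zs] := boolP (fval (p s) == 0);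
  have [/eqP zt|zt] := boolP (fval (p t) == 0).
- have ls := zP s (introT eqP zs); have lt := zP t (introT eqP zt).
  have := cross_le_ell (f t) (p s) (p t).
  rewrite /ell lt -{2}fst ls abs0 !mul0r !mulr0 addr0 lerz0 normr_le0 => /eqP e.
  by rewrite e eqxx in c0.
- have ls := zP s (introT eqP zs); rewrite (negPf zt) /= in ht.
  by rewrite (zero_big_cross_eq0 (p_prim s) ls) ?eqxx // in c0 => j; rewrite fst.
- have lt := zP t (introT eqP zt); rewrite (negPf zs) /= in hs.
  by rewrite (zero_big_cross_eq0 (p_prim t) lt) ?eqxx // in c0'.
rewrite (negPf zs) /= in hs; rewrite (negPf zt) /= in ht.
have [h|h] := leP (hgt (p s)) (hgt (p t)).
  by rewrite (@big_closest_cross_eq0 (f t) (p s) (p t)) ?eqxx in c0.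
by rewrite (@big_closest_cross_eq0 (f t) (p t) (p s)) ?eqxx // ltW in c0'.
Qed.

(** At most [n] exceptional points and one point per root are set aside. For each of the [s] others
    the product of the growth factors is at least [H / (2 m (5/2)^n)], and along each root the
    factors multiply to at most [H^2]. *)
Lemma card_points_le : exists s : nat, (k <= n + n + s)%N /\
  (H / (2 * m * (5 / 2) ^+ n)) ^+ s <= (H ^+ 2) ^+ n.
Proof.
have h2 := height_gt2; have m0 := m_gt0.
have HH1 : 1 <= H ^+ 2 by rewrite exprn_ege1 //; lra.
pose B := ~: exceptional.
have Bh t : t \in B -> hgt (p t) <= H ^+ 2.
  by rewrite !inE negb_or -leNgt => /andP [].
have p1 t : 1 <= hgt (p t).
  by apply: hgt_ge1; apply/eqP => e; have := p_prim t; rewrite e gcdz0.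
(* [X] holds the highest point with growth above 1 at root [i], if there is one; points outside [Ai]
   contribute the factor 1. *)
have ex i : exists X : {set 'I_k}, (#|X| <= 1)%N /\
    forall S : {set 'I_k}, S \subset B -> [disjoint S & X] ->
      \prod_(t in S) grow i (p t) <= H ^+ 2.
  pose Ai := [set t in B | 1 < grow i (p t)].
  have [A0|[t0 t0A]] := set_0Vmem Ai.
    exists set0; rewrite cards0; split=> // S SB _.
    rewrite big1 // => t tS; apply/eqP; rewrite eq_le grow_ge1 andbT leNgt.
    apply/negP => gt1; have : t \in Ai by rewrite inE gt1 (subsetP SB).
    by rewrite A0 inE.
  have [|||e eA [_ eP]] := @chain_prod_le R _ (fun t => hgt (p t))
     (fun t => grow i (p t)) Ai _ _ _ t0 t0A.
  - by move=> t _; apply: p1.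
  - by move=> t _; apply: grow_ge1.
  - move=> s t; rewrite !inE => /andP [_ gs] /andP [_ gt] st hst.
    by apply: grow_chain => //; apply: p_cross.
  exists [set e]; rewrite cards1; split=> // S SB SX.
  have eB : e \in B by move: eA; rewrite inE => /andP [].
  apply: le_trans (Bh e eB); apply: le_trans eP.
  rewrite big_mkcond [X in _ <= X]big_mkcond /=; apply: ler_prod => t _.
  have g1 := grow_ge1 i (p t).
  have [tS|tS] := boolP (t \in S); last by rewrite ler01 /=; case: ifP.
  rewrite (le_trans ler01) //=; case: ifP => // /negbT.
  rewrite in_setD1 in_set (subsetP SB _ tS) /= negb_and negbK => /orP [/eqP te|].
    by move: (disjointFr SX tS); rewrite te set11.
  by rewrite -leNgt.
have [X XP] := fin_all_exists ex.
pose S := B :\: \bigcup_i X i.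
exists #|S|; split.
  rewrite -[X in (X <= _)%N]card_ord -(cardC (mem exceptional)) -addnA.
  apply: leq_add card_exceptional _.
  have -> : #|[predC mem exceptional]| = #|B| by apply: eq_card => t; rewrite !inE.
  rewrite -(cardsID (\bigcup_i X i) B); apply: leq_add => //.
  apply: (leq_trans (subset_leq_card (subsetIr _ _))).
  apply: (@leq_trans (\sum_(i < n) 1)); last by rewrite sum1_card card_ord.
  elim/big_rec2: _ => [|i x Y _ hY]; first by rewrite cards0.
  apply: (leq_trans (leq_card_setU _ _)); apply: leq_add => //.
  by case: (XP i).
have -> : (H / (2 * m * (5 / 2) ^+ n)) ^+ #|S| =
    \prod_(t in S) (H / (2 * m * (5 / 2) ^+ n)) by rewrite prodr_const.
have c0 : 0 < 2 * m * (5 / 2) ^+ n.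
  by rewrite !mulr_gt0 ?exprn_gt0 //; lra.
apply: (@le_trans _ _ (\prod_(t in S) \prod_i grow i (p t))).
  apply: ler_prod => t; rewrite inE => /andP [_ tB].
  rewrite divr_ge0 ?(ltW c0) ?(ltW height_gt0) //= ler_pdivrMr // mulrC.
  apply: height_le_prod_grow => //; by move: tB; rewrite !inE negb_or => /andP [].
rewrite exchange_big /= -[X in _ <= _ ^+ X]card_ord -prodr_const.
apply: ler_prod => i _; rewrite prodr_ge0 /=; last first.
  by move=> t _; rewrite (le_trans ler01) ?grow_ge1.
have [_] := XP i; apply; first exact: subsetDl.
rewrite -setI_eq0; apply/eqP/setP => t; rewrite !inE; apply/negbTE/negP.
by case/andP => /andP [/negP h _] tX; apply: h; apply/bigcupP; exists i.
Qed.

End LinearForms.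

(** * Hadamard's inequality *)

Section Hadamard.
Local Open Scope sesquilinear_scope.

(** Gram-Schmidt gives [A = B S] with [S] unitary and [B] lower triangular. Then [|det A|] is the
    product of the [|B i i|], and corresponding rows of [A] and [B] have equal norms. *)
Lemma hadamard (C : numClosedFieldType) n (A : 'M[C]_n) :
  `|\det A| ^+ 2 <= \prod_i \sum_j `|A i j| ^+ 2.
Proof.
pose S := schmidt A; have US : S \is unitarymx by apply: schmidt_unitarymx.
have SS := unitarymxP US.
have detS : `|\det S| ^+ 2 = 1.
  by rewrite normCK -[X in _ * X^*]det_tr -det_map_mx -det_mulmx SS det1.
pose B := A *m S ^t*.
have BS : B *m S = A by rewrite /B -mulmxA (mulmx1C SS) mulmx1.
have trigB : is_trig_mx B.
  apply/is_trig_mxP => i j ij.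
  (* Row [i] of [A] lies in the span of the rows of [S] of index at most [i], all orthogonal to row
     [j]. *)
  have : (row i A <= kermx (col j (S ^t*)))%MS.
    apply: (submx_trans (row_schmidt_sub A i)); apply/sumsmx_subP => k ki.
    rewrite genmxE; apply/sub_kermxP; rewrite -/S; apply/rowP => q.
    have := congr1 (fun M : 'M_n => M k j) SS; rewrite !mxE ord1 => e.
    under eq_bigr do rewrite mxE [X in _ * X]mxE; rewrite e.
    by case: eqP ki ij => // -> /leq_ltn_trans h /h; rewrite ltnn.
  move/sub_kermxP => /rowP /(_ 0); rewrite !mxE => e; rewrite -[RHS]e.
  by apply: eq_bigr => k _; rewrite !mxE.
rewrite -{1}BS det_mulmx normrM exprMn detS mulr1 (det_trig trigB).
rewrite normr_prod -prodrXl; apply: ler_prod => i _; rewrite exprn_ge0 //=.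
have -> : \sum_j `|A i j| ^+ 2 = \sum_j `|B i j| ^+ 2.
  have e : A *m A ^t* = B *m B ^t*.
    rewrite /B trmx_mul map_mxM map_trmx trmxK map_mxCK mulmxA.
    by rewrite -[A *m _ *m S]mulmxA (mulmx1C SS) mulmx1.
  have := congr1 (fun M : 'M_n => M i i) e; rewrite !mxE => e'.
  rewrite (eq_bigr _ (fun j _ => normCK (A i j))) (eq_bigr _ (fun j _ => normCK (B i j))).
  transitivity (\sum_j A i j * (A ^t*) j i).
    by apply: eq_bigr => j _; rewrite !mxE.
  by rewrite e'; apply: eq_bigr => j _; rewrite [X in _ * X]mxE [X in _ * X^*]mxE.
by rewrite (bigD1 i) //= lerDl sumr_ge0 // => j _; rewrite exprn_ge0.
Qed.

End Hadamard.

(** * Bound for the discriminant by the height *)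

Section DiscriminantBound.
Variable R : rcfType.
Local Notation N := (@ComplexField.Normc.normc R).

Lemma normc_ge0 (z : R[i]) : 0 <= N z.
Proof. by case: z => x y; apply: sqrtr_ge0. Qed.

Lemma normc_gt0 (z : R[i]) : z != 0 -> 0 < N z.
Proof.
move=> z0; rewrite lt_def normc_ge0 andbT.
by apply: contra_neq z0 => /ComplexField.Normc.eq0_normc.
Qed.

Lemma normrC (z : R[i]) : `|z| = (N z)%:C%C.
Proof. by []. Qed.

Lemma normc_prod (I : finType) (P : pred I) (f : I -> R[i]) :
  N (\prod_(i | P i) f i) = \prod_(i | P i) N (f i).
Proof.
by elim/big_rec2: _ => [|i x y _ <-]; rewrite ?ComplexField.Normc.normc1
  ?ComplexField.Normc.normcM.
Qed.

Lemma normcX (z : R[i]) k : N (z ^+ k) = N z ^+ k.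
Proof.
elim: k => [|k IH]; first by rewrite !expr0 ComplexField.Normc.normc1.
by rewrite !exprS ComplexField.Normc.normcM IH.
Qed.

Lemma normcB (x y : R[i]) : N (x - y) <= N x + N y.
Proof. by rewrite -(normcN y) le_normcD. Qed.

Lemma normc_int (z : int) : N z%:~R = `|z|%:~R.
Proof.
have -> : (z%:~R : R[i]) = (z%:~R)%:C%C by rewrite rmorph_int.
by rewrite /= expr0n addr0 sqrtr_sqr intr_norm.
Qed.

Lemma normc_hadamard n (A : 'M[R[i]]_n) :
  N (\det A) ^+ 2 <= \prod_i \sum_j N (A i j) ^+ 2.
Proof.
have := hadamard A; rewrite normrC -rmorphXn /=.
have -> : \prod_i \sum_j `|A i j| ^+ 2 = (\prod_i \sum_j N (A i j) ^+ 2)%:C%C.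
  rewrite rmorph_prod; apply: eq_bigr => i _; rewrite rmorph_sum.
  by apply: eq_bigr => j _; rewrite normrC -rmorphXn.
by rewrite lecR.
Qed.

(** [A] is the homogeneous Vandermonde matrix, a row scaling of the ordinary one in the [a i / b i].
    Entries of row [i] are at most [max(|a i|, |b i|)^(n-1)], and Hadamard's inequality applies. *)
Lemma disc_le_of_neq0 n (a b : 'I_n -> R[i]) : (forall i, b i != 0) ->
  disc N a b <= n%:R ^+ n * (\prod_i Num.max (N (a i)) (N (b i))) ^+ (n.-1).*2.
Proof.
move=> b0.
pose A := \matrix_(i < n, j < n) (a i ^+ j * b i ^+ (n.-1 - j)).
have -> : disc N a b = N (\det A) ^+ 2.
  pose v : 'rV[R[i]]_n := \row_i (a i / b i).
  have -> : A = diag_mx (\row_i (b i ^+ n.-1)) *m (Vandermonde n v)^T.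
    apply/matrixP => i j; rewrite mul_diag_mx !mxE expr_div_n.
    have jn : (j <= n.-1)%N by have := ltn_ord j; lia.
    rewrite -{2}(subnK jn) exprD; field; exact: expf_neq0.
  rewrite det_mulmx det_tr det_diag det_Vandermonde ComplexField.Normc.normcM exprMn.
  have -> : disc N a b = (\prod_i \prod_(j | j != i) (N (b i) * N (b j)))
     * \prod_i \prod_(j | j != i) N (v 0 j - v 0 i).
    rewrite /disc -big_split /=; apply: eq_bigr => i _.
    rewrite -big_split /=; apply: eq_bigr => j _.
    rewrite -!ComplexField.Normc.normcM -normcN /wedge !mxE; congr N.
    by field; rewrite !b0.
  congr (_ * _).
    rewrite prod_offdiag_mul normc_prod -muln2 exprM; congr (_ ^+ 2).
    by rewrite -prodrXl; apply: eq_bigr => i _; rewrite mxE normcX.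
  rewrite prod_offdiag_sym; last by move=> i j; rewrite -normcN opprB.
  by rewrite normc_prod; congr (_ ^+ 2); apply: eq_bigr => i _; rewrite normc_prod.
apply: (le_trans (normc_hadamard A)).
rewrite -prodrXl -[X in _ ^+ X](card_ord n) -prodr_const -big_split /=.
apply: ler_prod => i _; rewrite sumr_ge0 /=; last by move=> j _; rewrite sqr_ge0.
set s := Num.max _ _.
apply: (@le_trans _ _ (\sum_(j < n) s ^+ (n.-1).*2)); last first.
  by rewrite sumr_const card_ord mulr_natl.
apply: ler_sum => j _; rewrite mxE ComplexField.Normc.normcM !normcX.
have jn : (j <= n.-1)%N by have := ltn_ord j; lia.
rewrite -muln2 exprM lerXn2r ?nnegrE ?mulr_ge0 ?exprn_ge0 ?normc_ge0 //.
  by rewrite le_max normc_ge0.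
rewrite -{2}(subnK jn) addnC exprD ler_pM ?exprn_ge0 ?normc_ge0 //;
by rewrite lerXn2r ?nnegrE ?normc_ge0 ?le_max ?normc_ge0 ?lexx ?orbT.
Qed.

(** The right side is the chord over [[0, 1]] of the convex function [(1 + t)^k]. *)
Lemma expr1D_le (t : R) k : 0 <= t -> t <= 1 -> (1 + t) ^+ k <= 1 + (2 ^+ k - 1) * t.
Proof.
move=> t0 t1; elim: k => [|k IH]; first by rewrite !expr0 subrr mul0r addr0.
rewrite exprSr exprS; have p : 1 <= (2 : R) ^+ k by rewrite exprn_ege1 //; lra.
have h : 0 <= 1 + t by lra.
have tp : 0 <= t * ((2 ^+ k - 1) * (1 - t)) by rewrite !mulr_ge0 //; lra.
by have := ler_wpM2r h IH; lra.
Qed.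

(* The shear b + t a leaves the discriminant unchanged and makes every b_i
   nonzero for small t > 0; let t tend to 0. *)
Lemma disc_le n (a b : 'I_n -> R[i]) :
  (forall i, (a i != 0) || (b i != 0)) ->
  disc N a b <= n%:R ^+ n * (\prod_i Num.max (N (a i)) (N (b i))) ^+ (n.-1).*2.
Proof.
move=> ab0; set K := (X in _ <= X).
have K0 : 0 <= K.
  by rewrite mulr_ge0 ?exprn_ge0 ?ler0n ?prodr_ge0 // => i _; rewrite le_max normc_ge0.
(* For [t < t0] the shear cannot cancel a nonzero [b i], as [t |a i| < |b i|]; the default 1 serves
   when all [b i] vanish. *)
pose t0 := \big[Num.min/1]_(i | b i != 0) (N (b i) / (N (a i) + 1)).
have t0_gt0 : 0 < t0.
  rewrite /t0; elim/big_rec: _ => [|i x bi x0]; first exact: ltr01.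
  by rewrite lt_min x0 andbT divr_gt0 ?normc_gt0 // ltr_wpDl ?normc_ge0.
have t0_le i : b i != 0 -> t0 * (N (a i) + 1) <= N (b i).
  move=> bi; rewrite -ler_pdivlMr ?ltr_wpDl ?normc_ge0 //.
  exact: bigmin_le_cond.
have key t : 0 < t -> t < t0 -> t <= 1 ->
    disc N a b <= K * (1 + (2 ^+ (n * (n.-1).*2) - 1) * t).
  move=> tp tt t1.
  have b'0 i : b i + t%:C%C * a i != 0.
    have [bi|bi] := eqVneq (b i) 0.
      move: (ab0 i); rewrite bi eqxx orbF add0r => ai; rewrite mulf_neq0 //.
      by apply/eqP => -[] e; rewrite e ltxx in tp.
    apply/eqP => e; have : N (b i) = t * N (a i).
      rewrite -[b i](addrK (t%:C%C * a i)) e sub0r normcN ComplexField.Normc.normcM.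
      by congr (_ * _); rewrite /= expr0n addr0 sqrtr_sqr gtr0_norm.
    have := t0_le i bi; have := normc_ge0 (a i); nra.
  have := disc_le_of_neq0 a b'0.
  have -> : disc N a (fun i => b i + t%:C%C * a i) = disc N a b.
    by apply: eq_bigr => i _; apply: eq_bigr => j _; congr N; rewrite /wedge; ring.
  move=> h; apply: (le_trans h).
  apply: (@le_trans _ _ (K * (1 + t) ^+ (n * (n.-1).*2))); last first.
    by rewrite ler_wpM2l // expr1D_le // ltW.
  rewrite /K -mulrA ler_wpM2l ?exprn_ge0 ?ler0n // exprM -exprMn lerXn2r ?nnegrE //.
  - by rewrite prodr_ge0 // => i _; rewrite le_max normc_ge0.
  - rewrite mulr_ge0 ?exprn_ge0 ?prodr_ge0 //; last by lra.
    by move=> i _; rewrite le_max normc_ge0.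
  rewrite -[X in _ ^+ X](card_ord n) -prodr_const -big_split /=.
  apply: ler_prod => i _; rewrite le_max normc_ge0 /=.
  set s := Num.max (N (a i)) (N (b i)).
  have s1 : N (a i) <= s by rewrite le_max lexx.
  have s2 : N (b i) <= s by rewrite le_max lexx orbT.
  have s0 := normc_ge0 (a i).
  rewrite ge_max; apply/andP; split; first by nra.
  apply: (le_trans (le_normcD _ _)); rewrite ComplexField.Normc.normcM.
  have -> : N t%:C%C = t by rewrite /= expr0n addr0 sqrtr_sqr gtr0_norm.
  by nra.
rewrite leNgt; apply/negP => hK.
set d := disc N a b in key hK *.
pose q : R := 2 ^+ (n * (n.-1).*2) - 1.
have q0 : 0 <= q by rewrite subr_ge0 exprn_ege1 //; lra.
have Kq : 0 <= K * q by rewrite mulr_ge0.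
pose t := Num.min (t0 / 2) (Num.min 1 ((d - K) / 2 / (K * q + 1))).
have tp : 0 < t.
  by rewrite !lt_min ltr01 !divr_gt0 //=; [lra | exact: ltr_wpDl].
have t1 : t <= t0 / 2 by rewrite ge_min lexx.
have t2 : t <= 1 by rewrite !ge_min lexx orbT.
have t3 : t * (K * q + 1) <= (d - K) / 2.
  by rewrite -ler_pdivlMr ?ltr_wpDl // !ge_min lexx !orbT.
have := key t tp _ t2; rewrite -/q => /(_ ltac:(lra)); nra.
Qed.

End DiscriminantBound.

(** A basis change of determinant 1 preserves the discriminant, so [disc_le] applies to the values
    of the forms at [E1] and [E2]. *)
Lemma disc_le_height (R : rcfType) n (a b : 'I_n -> R[i]) E1 E2 :
  (1 < n)%N -> (forall i j, i != j -> wedge a b i j != 0) -> cross E1 E2 = 1 ->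
  disc (@ComplexField.Normc.normc R) a b
  <= n%:R ^+ n * height (@ComplexField.Normc.normc R) a b E1 E2 ^+ (n.-1).*2.
Proof.
move=> n1 w0 e12; have s0 := @sz_gt0 R _ _ (@normc_ge0 R)
  (@ComplexField.Normc.eq0_normc R) (@ComplexField.Normc.normcM R) (@normcB R)
  n a b E1 E2 e12 n1 w0.
have -> : disc (@ComplexField.Normc.normc R) a b =
    disc (@ComplexField.Normc.normc R) (fun i => lin a b i E1) (fun i => lin a b i E2).
  apply: eq_bigr => i _; apply: eq_bigr => j _; rewrite -normcN.
  congr ComplexField.Normc.normc.
  have := wedge_cross a b i j E1 E2; rewrite e12 mulr1 => ->.
  by rewrite /wedge opprB [lin a b i E2 * _]mulrC.
apply: disc_le => i; have := s0 i; apply: contraTT.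
rewrite negb_or !negbK => /andP [/eqP e1 /eqP e2].
by rewrite /sz e1 e2 ComplexField.Normc.normc0 maxxx ltxx.
Qed.

(** * Integral forms: values, divisibility and factorisation *)

Section IntegralForms.
Import mpoly.

Lemma mmap_map_mpoly n (A B S : comNzRingType) (f : {rmorphism A -> B})
    (g : {rmorphism B -> S}) (h : 'I_n -> S) (p : {mpoly A[n]}) :
  injective f -> mmap g h (map_mpoly f p) = mmap (g \o f) h p.
Proof.
move=> fI; rewrite /mmap (perm_big _ (msupp_map_mpoly p fI)) /=.
by apply: eq_bigr => m _; rewrite mcoeff_map_mpoly.
Qed.

Lemma rmorph_mmap n (A S S' : comNzRingType) (f : {rmorphism A -> S})
    (g : {rmorphism S -> S'}) (h : 'I_n -> S) (p : {mpoly A[n]}) :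
  g (mmap f h p) = mmap (g \o f) (g \o h) p.
Proof.
rewrite /mmap rmorph_sum; apply: eq_bigr => m _; rewrite rmorphM /=; congr (_ * _).
by rewrite /mmap1 rmorph_prod; apply: eq_bigr => i _; rewrite rmorphXn.
Qed.

Lemma size_mmap_le (A : idomainType) n (h : 'I_n -> {poly A}) (p : {mpoly A[n]}) :
  (forall i, (size (h i) <= 2)%N) -> (size (mmap polyC h p) <= msize p)%N.
Proof.
move=> h2; rewrite /mmap big_seq; apply: (leq_trans (size_sum _ _ _)).
apply/bigmax_leqP_seq => m _ mp; apply: leq_trans (msize_mdeg_lt mp).
rewrite mul_polyC; apply: (leq_trans (size_scale_leq _ _)).
rewrite /mmap1 mdegE; elim/big_rec2: _ => [|i d q _ IH]; first by rewrite size_poly1.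
apply: (leq_trans (size_polyMleq _ _)).
set s1 := size _; have s1P : (s1 <= (m i).+1)%N.
  apply: (leq_trans (size_poly_exp_leq _ _)).
  rewrite ltnS -[X in (_ <= X)%N]mul1n leq_mul2r.
  by apply/orP; right; have := h2 i; case: (size (h i)) => [|[|[]]].
by move: s1 s1P IH; move: (size d) (m i) => s2 mi s1; lia.
Qed.


(** The integer is the homogenisation of [f] at [(u, v)]: with [d = #|A|], it is [v^d f(u/v)] if [v]
    is nonzero and [c u^d] if [v = 0]. *)
Lemma homogenize_prod (K : numFieldType) (I : finType) (A : {set I}) (th : I -> K)
    (c : K) (f : {poly int}) (u v : int) :
  map_poly intr f = c *: \prod_(i in A) ('X - (th i)%:P) ->
  exists z : int, z%:~R = c * \prod_(i in A) (u%:~R - th i * v%:~R).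
Proof.
set q := map_poly intr f => qE; set d := #|A|.
pose P := \prod_(i in A) ('X - (th i)%:P).
have sP : size P = d.+1 by rewrite /P -big_enum size_prod_XsubC -cardE.
have sq : (size q <= d.+1)%N by rewrite qE -sP size_scale_leq.
exists (\sum_(j < d.+1) f`_j * u ^+ j * v ^+ (d - j)).
have -> : (\sum_(j < d.+1) f`_j * u ^+ j * v ^+ (d - j))%:~R =
   \sum_(j < d.+1) q`_j * u%:~R ^+ j * v%:~R ^+ (d - j) :> K.
  rewrite rmorph_sum; apply: eq_bigr => j _.
  by rewrite !rmorphM !rmorphXn /= /q coef_map.
have [->|v0] := eqVneq v 0.
  rewrite big_ord_recr /= subnn expr0 mulr1 big1 ?add0r; last first.
    move=> j _; rewrite /= mulr0z expr0n subn_eq0 leqNgt ltn_ord mulr0 //.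
  have -> : q`_d = c.
    rewrite qE coefZ; have : P \is monic by apply: monic_prod_XsubC.
    by rewrite monicE /lead_coef sP => /eqP ->; rewrite mulr1.
  congr (_ * _); rewrite -prodr_const; apply: eq_bigr => i _.
  by rewrite mulr0z mulr0 subr0.
have v0' : v%:~R != 0 :> K by rewrite intr_eq0.
transitivity (v%:~R ^+ d * q.[u%:~R / v%:~R]).
  rewrite (horner_coef_wide _ sq) mulr_sumr; apply: eq_bigr => j _.
  have jd : (j <= d)%N by rewrite -ltnS.
  have -> : v%:~R ^+ d = v%:~R ^+ (d - j) * v%:~R ^+ j :> K by rewrite -exprD subnK.
  rewrite expr_div_n; field; exact: expf_neq0.
rewrite qE hornerZ horner_prod mulrCA -prodr_const -big_split /=; congr (_ * _).
apply: eq_bigr => i _; rewrite hornerXsubC; by field.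
Qed.

Section ProductOfLinearForms.
Variables (R : rcfType) (n : nat) (F : {mpoly int[2]}) (a b : 'I_n -> R[i]).
Local Notation N := (@ComplexField.Normc.normc R).
Hypothesis FE : map_mpoly intr F
  = \prod_(i < n) (a i *: 'X_ord0 - b i *: 'X_ord_max) :> {mpoly R[i][2]}.

(** Substitution into [F] is computed on its complex linear factors: [g] is the identity for values,
    and [polyC] for univariate specialisation. *)
Lemma mmap_form (S : comNzRingType) (g : {rmorphism R[i] -> S}) (h : 'I_2 -> S) :
  mmap intr h F = \prod_i (g (a i) * h ord0 - g (b i) * h ord_max).
Proof.
transitivity (mmap (g \o intr) h F).
  by apply: eq_bigr => m _; rewrite /= rmorph_int.
rewrite -mmap_map_mpoly; last exact: intr_inj.
rewrite FE rmorph_prod; apply: eq_bigr => i _.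
by rewrite rmorphB /= !mmapZ !mmapX !mmap1U.
Qed.

Lemma bin_eval_mmap (x y : int) :
  bin_eval F x y = mmap intr (fun i : 'I_2 => if i == ord0 then x else y) F.
Proof. by apply: eq_bigr => m _; rewrite /= intz. Qed.

Lemma bin_eval_lin (P : int * int) :
  (bin_eval F P.1 P.2)%:~R = \prod_i lin a b i P.
Proof.
rewrite bin_eval_mmap rmorph_mmap.
transitivity (mmap intr
    (intr \o (fun i : 'I_2 => if i == ord0 then P.1 else P.2)) F : R[i]).
  by apply: eq_bigr => m _; rewrite /= intz.
by rewrite (mmap_form idfun).
Qed.

Lemma fval_bin_eval P : fval N a b P = `|bin_eval F P.1 P.2|%:~R.
Proof. by rewrite -normc_int bin_eval_lin normc_prod. Qed.

(* In a basis Z, Z' of the integer lattice, W = u Z + v Z' with v = cross Z W,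
   so F W is congruent to F (u Z) = 0 modulo v. *)
Lemma cross_dvd_bin_eval i Z W : gcdz Z.1 Z.2 = 1 -> lin a b i Z = 0 ->
  (cross Z W %| bin_eval F W.1 W.2)%Z.
Proof.
move=> gZ lZ.
have [s [t st]] : exists s t : int, s * Z.1 + t * Z.2 = 1.
  by case: (Bezoutz Z.1 Z.2) => s [t e]; exists s, t; rewrite e gZ.
pose u := s * W.1 + t * W.2; pose v := cross Z W.
have W1 : W.1 = u * Z.1 - v * t.
  by rewrite -[LHS]mulr1 -st /u /v /cross; ring.
have W2 : W.2 = u * Z.2 + v * s.
  by rewrite -[LHS]mulr1 -st /u /v /cross; ring.
pose h (j : 'I_2) : {poly int} := if j == ord0 then (u * Z.1)%:P - t%:P * 'X
  else (u * Z.2)%:P + s%:P * 'X.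
pose q : {poly int} := mmap intr h F.
have qE x : q.[x] = bin_eval F (u * Z.1 - x * t) (u * Z.2 + x * s).
  rewrite bin_eval_mmap -horner_evalE rmorph_mmap; apply: eq_bigr => m _.
  rewrite /= rmorph_int; congr (_ * _); apply: eq_bigr => j _; congr (_ ^+ _).
  by rewrite /= /horner_eval /h; case: (j == ord0); rewrite !hornerE [x * _]mulrC.
have q0 : q.[0] = 0.
  apply/eqP; rewrite qE !mul0r addr0 subr0 -(intr_eq0 R[i]).
  rewrite (bin_eval_lin (u * Z.1, u * Z.2)) (bigD1 i) //=.
  have -> : lin a b i (u * Z.1, u * Z.2) = u%:~R * lin a b i Z.
    by rewrite /lin /= !rmorphM /=; ring.
  by rewrite lZ mulr0 mul0r.
have -> : bin_eval F W.1 W.2 = q.[v] by rewrite qE -W1 -W2.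
have /factor_theorem [q' ->] : root q 0 by apply/rootP.
by rewrite hornerM !hornerE dvdz_mull.
Qed.

Lemma cross_le_fval i Z W : gcdz Z.1 Z.2 = 1 -> lin a b i Z = 0 ->
  fval N a b W != 0 -> `|cross Z W|%:~R <= fval N a b W.
Proof.
move=> gZ lZ; rewrite fval_bin_eval intr_eq0 normr_eq0 ler_int => F0.
have := cross_dvd_bin_eval W gZ lZ; rewrite dvdzE => /dvdn_leq h.
by rewrite -!abszE lez_nat h // absz_gt0.
Qed.

Hypothesis F_homog : F \is n.-homog.
Hypothesis F_red : reducible F.
Hypothesis n_gt1 : (1 < n)%N.
Hypothesis wedge_neq0 : forall i j, i != j -> wedge a b i j != 0.

(* Gauss's lemma for the polynomial F(X, kX + 1), where k is chosen so that it
   has degree n. *)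
Lemma form_split : exists (A : {set 'I_n}) (cA cB : R),
  [/\ cA * cB = 1, 0 < cA, 0 < cB, A != set0 & ~: A != set0] /\
  discrete N a b A cA /\ discrete N a b (~: A) cB.
Proof.
(* In the standard basis the test point is [W = (1, k)], and [F(X, kX + 1)] has leading coefficient
   [F(W) != 0]. *)
have [W [c1 _ W0]] := @test_point R _ N (@normc_ge0 R) (@ComplexField.Normc.eq0_normc R)
  (@ComplexField.Normc.normcM R) (@normcB R) (@normc_int R) n a b
  (1, 0) (0, 1) erefl n_gt1 wedge_neq0.
have {}c1 : W.1 = 1 by move: c1; rewrite /cross /= mulr1 mulr0 subr0.
pose k := W.2; pose c i := lin a b i W.
have cE i : c i = a i - b i * k%:~R by rewrite /c /lin c1 mulr1.
pose h (S : comNzRingType) (j : 'I_2) : {poly S} :=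
  if j == ord0 then 'X else k%:~R *: 'X + 1.
have hm (S S' : comNzRingType) (f : {rmorphism S -> S'}) j : map_poly f (h S j) = h S' j.
  rewrite /h; case: (j == ord0); first by rewrite map_polyX.
  by rewrite rmorphD /= map_polyZ map_polyX rmorph1 rmorph_int.
pose p : {poly int} := mmap intr (h int) F.
have pm (S : comNzRingType) : map_poly intr p = mmap intr (h S) F.
  rewrite rmorph_mmap; apply: eq_bigr => m _; rewrite /= rmorph_int; congr (_ * _).
  by apply: eq_bigr => j _; rewrite /= hm.
pose th i := b i / c i.
pose Pr := \prod_(i < n) ('X - (th i)%:P).
have pC : map_poly intr p = (\prod_i c i) *: Pr.
  rewrite pm (mmap_form polyC) /= -mul_polyC rmorph_prod -big_split /=.
  apply: eq_bigr => i _; rewrite /h /=.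
  have e : b i = c i * th i by rewrite /th mulrC divfK //; exact: W0.
  rewrite mulrBr -polyCM -e cE polyCB polyCM -mul_polyC; ring.
have c_neq0 : \prod_i c i != 0 by apply/prodf_neq0 => i _; apply: W0.
have sp : size p = n.+1.
  rewrite -(size_map_inj_poly (f := intr : int -> R[i])) //; last exact: intr_inj.
  by rewrite pC size_scale // /Pr -big_enum size_prod_XsubC -cardE card_ord.
(* Substitution does not raise degrees, and the degrees of [G] and [H] add up to at most [n], the
   degree of [p]; so neither drops and both images are non-constant. *)
have [zg [zh [pgh sg sh]]] : exists zg zh : {poly int},
    [/\ p = zg * zh, (1 < size zg)%N & (1 < size zh)%N].
  case: F_red => G [H [G1 H1 FGH]].
  have hs j : (size (h rat j) <= 2)%N.
    rewrite /h; case: (j == ord0); first by rewrite size_polyX.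
    apply: (leq_trans (size_polyD _ _)); rewrite size_poly1 geq_max andbT.
    by apply: (leq_trans (size_scale_leq _ _)); rewrite size_polyX.
  pose g := mmap polyC (h rat) G; pose g' := mmap polyC (h rat) H.
  have sg := size_mmap_le G hs; have sh := size_mmap_le H hs.
  have pQ : map_poly intr p = g * g'.
    rewrite pm /g /g' -rmorphM -FGH /=; 
    apply: etrans (esym (@mmap_map_mpoly 2 int rat {poly rat} intr polyC (h rat) F _));
      last exact: intr_inj.
    by apply: eq_bigr => m _; rewrite /= rmorph_int.
  have sF : (msize (map_mpoly intr F : {mpoly rat[2]}) <= n.+1)%N.
    rewrite msizeE; apply/bigmax_leqP_seq => m + _.
    rewrite (perm_mem (msupp_map_mpoly F _)); last exact: intr_inj.
    by move=> mF; rewrite (dhomogP _ _ _ F_homog m mF).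
  have G0 : G != 0 by apply: contraTneq G1 => ->; rewrite msize0.
  have H0 : H != 0 by apply: contraTneq H1 => ->; rewrite msize0.
  move: sF; rewrite FGH msizeM // => sF.
  have sgg : (size g + size g')%N = n.+2.
    have gg0 : g * g' != 0.
      by rewrite -pQ -size_poly_eq0 size_map_inj_poly ?sp //; exact: intr_inj.
    have [g0 g'0] : g != 0 /\ g' != 0 by apply/andP; rewrite -negb_or -mulf_eq0.
    have e : n.+1 = (size g + size g').-1.
      by rewrite -size_mul // -pQ size_map_inj_poly ?sp //; exact: intr_inj.
    have s0 : (0 < size g)%N by rewrite lt0n size_poly_eq0.
    by move: e s0; move: (size g) (size g') => s1 s2; lia.
  have /dvdpP_rat_int [zg [r r0 gE] [zh pE]] : g %| map_poly intr p.
    by rewrite pQ dvdp_mulr.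
  exists zg, zh.
  have szg : size zg = size g.
    by rewrite gE size_scale // size_map_inj_poly //; exact: intr_inj.
  have [zg0 zh0] : zg != 0 /\ zh != 0.
    by apply/andP; rewrite -negb_or -mulf_eq0 -pE -size_poly_eq0 sp.
  have e : n.+1 = (size g + size zh).-1 by rewrite -szg -size_mul // -pE sp.
  have {}sg : (size g <= msize G)%N by [].
  have {}sh : (size g' <= msize H)%N by [].
  move: sF G1 H1 sg sh sgg e; rewrite szg.
  move: (msize G) (msize H) (size g) (size g') (size zh) => s1 s2 s3 s4 s5 *.
  by split=> //; lia.
pose gC : {poly R[i]} := map_poly intr zg; pose hC : {poly R[i]} := map_poly intr zh.
have ghC : gC * hC = (\prod_i c i) *: Pr by rewrite -rmorphM -pgh.
(* Over the complex numbers [p] splits, so its factor is given by a subset of the roots. *)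
have [m gm] : {m | gC %= \prod_(i <- mask m (index_enum 'I_n)) ('X - (th i)%:P)}.
  by apply: dvdp_prod_XsubC; rewrite -(dvdpZr _ _ c_neq0) -ghC dvdp_mulr.
pose A : {set 'I_n} := [set i in mask m (index_enum 'I_n)].
pose PA := \prod_(i in A) ('X - (th i)%:P).
pose PB := \prod_(i in ~: A) ('X - (th i)%:P).
have mA : \prod_(i <- mask m (index_enum 'I_n)) ('X - (th i)%:P) = PA.
  rewrite big_uniq ?mask_uniq ?index_enum_uniq //=.
  by apply: eq_bigl => i; rewrite inE.
rewrite mA in gm.
have PE : Pr = PA * PB.
  rewrite /Pr (bigID (mem A)) /=; congr (_ * _).
  by apply: eq_bigl => i; rewrite !inE.
have PA0 : PA != 0 by apply/monic_neq0/monic_prod_XsubC.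
have PB0 : PB != 0 by apply/monic_neq0/monic_prod_XsubC.
have [cg cg0 gE] : exists2 cg, cg != 0 & gC = cg *: PA.
  have /eqpP [[x y] /= /andP [x0 y0] e] := gm; exists (x^-1 * y).
    by rewrite mulf_neq0 ?invr_eq0.
  by rewrite -scalerA -e scalerA mulVf ?scale1r.
pose ch := (\prod_i c i) / cg.
have ch0 : ch != 0 by rewrite mulf_neq0 ?invr_eq0.
have hE : hC = ch *: PB.
  apply: (mulfI PA0); apply: (scalerI cg0); rewrite scalerAl -gE ghC PE.
  by rewrite -scalerAr scalerA /ch mulrCA divff // mulr1.
have key (B : {set 'I_n}) (f : {poly int}) (e : R[i]) :
    map_poly intr f = e *: \prod_(i in B) ('X - (th i)%:P) ->
    discrete N a b B (N e / \prod_(i in B) N (c i)).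
  move=> fE P.
  (* In the coordinates [u = P.1], [v = P.2 - k P.1] one has [L_i(P) = c_i (u - th_i v)]. *)
  have [z zE] := homogenize_prod P.1 (P.2 - k * P.1) fE.
  have -> : N e / \prod_(i in B) N (c i) * \prod_(i in B) N (lin a b i P) = `|z|%:~R.
    rewrite -normc_int zE ComplexField.Normc.normcM -mulrA; congr (_ * _).
    rewrite normc_prod -prodfV -big_split /=; apply: eq_bigr => i _.
    have -> : lin a b i P = c i * (P.1%:~R - th i * (P.2 - k * P.1)%:~R).
      rewrite mulrBr mulrA /th [c i * (b i / _)]mulrC divfK //; last exact: W0.
      by rewrite cE /lin rmorphB rmorphM /=; ring.
    rewrite ComplexField.Normc.normcM mulrA mulVf ?mul1r //.
    by rewrite gt_eqF // normc_gt0 //; exact: W0.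
  by rewrite intr_eq0 normr_eq0 => z0; rewrite -[1]/(1%:~R) ler_int -gtz0_ge1 normr_gt0.
have cp (B : {set 'I_n}) : 0 < \prod_(i in B) N (c i).
  by apply: prodr_gt0 => i _; apply: normc_gt0; exact: W0.
exists A, (N cg / \prod_(i in A) N (c i)), (N ch / \prod_(i in ~: A) N (c i)).
split; last by split; [apply: key gE | apply: key hE].
have size_ne0 (B : {set 'I_n}) (f : {poly int}) e : (1 < size f)%N -> e != 0 ->
    map_poly intr f = e *: \prod_(i in B) ('X - (th i)%:P) -> B != set0.
  move=> f1 e0 fE; apply: contraTneq f1 => B0; rewrite -leqNgt.
  rewrite -(size_map_inj_poly (f := intr : int -> R[i])) //; last exact: intr_inj.
  by rewrite fE B0 big_set0 size_scale // size_poly1.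
split.
- rewrite mulrACA -invfM -ComplexField.Normc.normcM /ch [cg * _]mulrC divfK //.
  rewrite normc_prod.
  have -> : \prod_(i in A) N (c i) * \prod_(i in ~: A) N (c i) = \prod_i N (c i).
    by rewrite [RHS](bigID (mem A)) /=; congr (_ * _); apply: eq_bigl => i; rewrite !inE.
  by rewrite divff // gt_eqF //; apply: prodr_gt0 => i _; apply: normc_gt0; exact: W0.
- by rewrite divr_gt0 ?normc_gt0 ?cp.
- by rewrite divr_gt0 ?normc_gt0 ?cp.
- exact: size_ne0 sg cg0 gE.
- exact: size_ne0 sh ch0 hE.
Qed.

End ProductOfLinearForms.

End IntegralForms.

(* Near-minima, cardinality and proportional primitive points *)
From mathcomp Require Import boolp classical_sets cardinality.
From mathcomp Require Import reals exp.

(** The infimum may not be attained, but it is at least [c > 0], so some value lies below twice the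
    infimum. *)
Lemma exists_near_min (R : realType) (T : Type) (P : T -> Prop) (f : T -> R) (c : R) :
  0 < c -> (forall x, P x -> c <= f x) -> (exists x, P x) ->
  exists2 x, P x & forall y, P y -> f x <= 2 * f y.
Proof.
move=> c0 cf [x0 Px0].
pose E : set R := (fun r => exists2 x, P x & f x = r)%classic.
have E0 : nonempty E by exists (f x0), x0.
have lbE : lbound E c by move=> _ [x Px <-]; apply: cf.
have cE := lb_le_inf E0 lbE.
have [||_ [x Px <-] fx] := @inf_adherent _ E (inf E) _ _.
- exact: lt_le_trans cE.
- by split=> //; exists c.
exists x => // y Py; apply: (le_trans (ltW fx)).
have : inf E <= f y by apply: (ge_inf (ex_intro _ c lbE)); exists y.
by lra.
Qed.

(** An infinite [A] would contain injective families of every size, against the bound [B]. *)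
Lemma at_most_of_families (R : realType) (T : pointedType) (A : set T) (B : R) :
  (forall k (f : 'I_k -> T), injective f -> (forall i, A (f i)) -> k%:R <= B) ->
  at_most A B.
Proof.
move=> AB.
have fam k : (`I_k #<= A)%card -> k%:R <= B.
  move=> /pcard_leP /injfunPex [g gA gI].
  apply: (AB k (fun i : 'I_k => g i)) => [i j e|i].
    by apply/val_inj/gI => //; rewrite inE /=.
  by apply: gA => /=.
have [/finite_setP [k Ak]|Ainf] := pselect (finite_set A).
  by exists k; split; [rewrite (card_le_eql Ak) | apply: fam; rewrite (card_le_eqr Ak)].
have h k : k%:R <= B.
  by apply/fam/(card_le_trans (card_leT _))/infiniteP.
have := h (Num.truncn B).+1.
have B0 : 0 <= B by have := h 0%N.
by rewrite leNgt truncnS_gt.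
Qed.

Lemma prim_cross_eq0 (P Q : int * int) : gcdz P.1 P.2 = 1 -> gcdz Q.1 Q.2 = 1 ->
  cross P Q = 0 -> Q = P \/ Q = (- P.1, - P.2).
Proof.
move=> gP gQ /eqP; rewrite subr_eq0 => /eqP c0.
have [s [t st]] : exists s t : int, s * P.1 + t * P.2 = 1.
  by case: (Bezoutz P.1 P.2) => s [t e]; exists s, t; rewrite e gP.
pose u := s * Q.1 + t * Q.2.
have Q1 : Q.1 = u * P.1.
  rewrite -[LHS]mulr1 -st /u.
  have -> : (s * Q.1 + t * Q.2) * P.1 = s * Q.1 * P.1 + t * (P.1 * Q.2) by ring.
  by rewrite c0; ring.
have Q2 : Q.2 = u * P.2.
  rewrite -[LHS]mulr1 -st /u.
  have -> : Q.2 * (s * P.1 + t * P.2) = s * (P.1 * Q.2) + t * Q.2 * P.2 by ring.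
  by rewrite c0; ring.
have u1 : `|u| = 1.
  by move: gQ; rewrite Q1 Q2 -mulz_gcdr gP mulr1.
have [u0|u0] : u = 1 \/ u = -1 by lia.
  by left; rewrite [Q]surjective_pairing Q1 Q2 u0 !mul1r -surjective_pairing.
by right; rewrite [Q]surjective_pairing Q1 Q2 u0 !mulN1r.
Qed.

(** * Consequences of the bound on [m] for real powers *)

(* Here D0 stands for |D| and M for the height of F in some basis of Z^2. *)
Section PowerBounds.
Variables (R : realType) (n : nat) (m eps D0 : R).
Hypothesis n_ge3 : (3 <= n)%N.
Hypothesis eps_gt0 : 0 < eps.
Hypothesis eps_lt : eps < 1 / (4 * (n%:R - 1)).
Hypothesis m_ge1 : 1 <= m.
Hypothesis D_ge0 : 0 <= D0.
Hypothesis m_le : m <= D0 `^ (1 / (4 * (n%:R - 1)) - eps)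
           / ((7 / 2) `^ (n%:R / 2) * n%:R `^ (n%:R / (4 * (n%:R - 1)))).

Let e : R := 1 / (4 * (n%:R - 1)) - eps.
Let s : R := (7 / 2) `^ (n%:R / 2).

Lemma natr_sub1_gt0 : 0 < n%:R - 1 :> R.
Proof. by rewrite subr_gt0 ltr1n; case: n n_ge3 => [|[]]. Qed.

Lemma e_gt0 : 0 < e.
Proof. by rewrite subr_gt0. Qed.

Lemma s_sqr : s ^+ 2 = (7 / 2) ^+ n.
Proof.
have h : (0 : R) <= 7 / 2 by lra.
rewrite -powR_mulrn ?powR_ge0 // /s -powRrM divfK //.
  by rewrite powR_mulrn.
by apply: lt0r_neq0.
Qed.

Lemma s_ge1 : 1 <= s.
Proof.
rewrite -[X in X <= _](powRr0 (7 / 2)); apply: ler_powR; first by lra.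
by rewrite divr_ge0.
Qed.

Lemma ms_root_le_discriminant : m * s * n%:R `^ (n%:R / (4 * (n%:R - 1))) <= D0 `^ e.
Proof.
rewrite -mulrA -ler_pdivlMr // mulr_gt0 ?powR_gt0 //; first by lra.
by rewrite ltr0n; case: n n_ge3.
Qed.

Lemma natr_ge1 : 1 <= n%:R :> R.
Proof. by rewrite ler1n; case: n n_ge3. Qed.

Lemma ms_le_discriminant : m * s <= D0 `^ e.
Proof.
apply: le_trans ms_root_le_discriminant; rewrite ler_peMr //.
  by rewrite mulr_ge0 ?(le_trans ler01) // s_ge1.
rewrite -[X in X <= _](powRr0 n%:R); apply: (ler_powR natr_ge1).
by rewrite divr_ge0 // mulr_ge0 // ltW // natr_sub1_gt0.
Qed.

Lemma ms_ge1 : 1 <= m * s.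
Proof. by rewrite -[1]mulr1 ler_pM // s_ge1. Qed.

Lemma discriminant_ge1 : 1 <= D0.
Proof.
rewrite leNgt; apply/negP => D1; have := le_trans ms_ge1 ms_le_discriminant.
have E : (1 : R) `^ e = 1 by rewrite powR1.
rewrite leNgt; apply/negP; rewrite negbK -[X in _ < X]E.
by rewrite gt0_ltr_powR ?e_gt0 // nnegrE.
Qed.

Lemma discriminant_ge : m ^+ 2 * 2 ^+ (n * n.-1) <= D0.
Proof.
have nu := natr_sub1_gt0; pose q : R := 1 / (4 * (n%:R - 1)).
have h1 : m * s <= D0 `^ q.
  apply: (le_trans ms_le_discriminant); apply: (ler_powR discriminant_ge1).
  by rewrite /e /q lerBlDr lerDl ltW.
have h2 : (D0 `^ q) ^+ (4 * n.-1) = D0.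
  rewrite -powR_mulrn ?powR_ge0 // -powRrM.
  have -> : q * (4 * n.-1)%:R = 1; last by rewrite powRr1.
  rewrite natrM -subn1 natrB; last by case: n n_ge3.
  by rewrite /q mul1r mulVf // gt_eqF // mulr_gt0.
have ms0 : 0 <= m * s := le_trans ler01 ms_ge1.
have : (m * s) ^+ (4 * n.-1) <= D0.
  by rewrite -h2 lerXn2r ?nnegrE ?powR_ge0.
apply: le_trans.
have -> : (4 * n.-1 = 2 * (n.-1 + n.-1))%N by lia.
have e2 : (m * s) ^+ 2 = m ^+ 2 * (7 / 2) ^+ n by rewrite exprMn s_sqr.
rewrite [X in _ <= X]exprM e2 [X in _ <= X]exprD.
have K1 k : 1 <= (7 / 2 : R) ^+ k by rewrite exprn_ege1 //; lra.
have m1 : 1 <= m ^+ 2 by rewrite exprn_ege1.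
have mK : 1 <= m ^+ 2 * (7 / 2) ^+ n by rewrite -[X in X <= _]mulr1 ler_pM.
apply: ler_pM; rewrite ?sqr_ge0 ?exprn_ge0 //.
  apply: (@le_trans _ _ (m ^+ 2 * (7 / 2) ^+ n)).
    by rewrite ler_peMr // sqr_ge0.
  rewrite -[X in X <= _]expr1; apply: ler_weXn2l => //.
  by case: n n_ge3 => [|[]].
rewrite exprM; apply: lerXn2r; rewrite ?nnegrE ?exprn_ge0 ?(le_trans ler01 mK) //.
apply: (@le_trans _ _ ((7 / 2) ^+ n)); last by rewrite ler_peMl // exprn_ge0 //; lra.
by rewrite lerXn2r ?nnegrE //; lra.
Qed.

Variable M : R.
Hypothesis M_gt0 : 0 < M.
Hypothesis D_le : D0 <= n%:R ^+ n * M ^+ (n.-1).*2.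

Let del : R := 2 * (n%:R - 1) * eps.

(** Insert [D_le] in the bound on [m]: [2(n-1) e = 1/2 - del], and the power of [n] in the
    denominator absorbs [n^(n e)]. *)
Lemma mahler_powR_ge : m * s <= M `^ (1 / 2 - del).
Proof.
have nu := natr_sub1_gt0; have n1 := natr_ge1; have e0 := e_gt0.
have npos : 0 < n%:R :> R by lra.
have dE : 1 / 2 - del = ((n.-1).*2)%:R * e.
  have -> : ((n.-1).*2)%:R = 2 * (n%:R - 1) :> R.
    rewrite -mul2n natrM -subn1 natrB //; by case: n n_ge3.
  by rewrite /del /e; field; rewrite gt_eqF.
have h : D0 `^ e <= n%:R `^ (n%:R / (4 * (n%:R - 1))) * M `^ (1 / 2 - del).
  apply: (@le_trans _ _ ((n%:R ^+ n * M ^+ (n.-1).*2) `^ e)).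
    by rewrite ge0_ler_powR ?nnegrE ?(ltW e0) // (le_trans D_ge0).
  rewrite powRM ?exprn_ge0 ?(ltW M_gt0) ?(ltW npos) //.
  rewrite dE powRrM powR_mulrn ?(ltW M_gt0) // ler_wpM2r ?powR_ge0 //.
  rewrite -powR_mulrn ?(ltW npos) // -powRrM; apply: (ler_powR n1).
  rewrite ler_pM2l // /e -[X in _ <= X]div1r lerBlDr lerDl ltW //.
have := le_trans ms_root_le_discriminant h; rewrite [X in _ <= X]mulrC.
by rewrite ler_pM2r // powR_gt0.
Qed.

Lemma del_lt : del < 1 / 2.
Proof.
have nu := natr_sub1_gt0; have := eps_lt; rewrite ltr_pdivlMr ?mulr_gt0 // => h.
by rewrite /del; lra.
Qed.

Lemma del_gt0 : 0 < del.
Proof. by rewrite /del !mulr_gt0 // natr_sub1_gt0. Qed.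

(** This is the positive lower bound for heights that lets a nearly minimal basis be chosen. *)
Lemma mahler_ge1 : 1 <= M.
Proof.
rewrite leNgt; apply/negP => M1; have := le_trans ms_ge1 mahler_powR_ge.
have E : (1 : R) `^ (1 / 2 - del) = 1 by rewrite powR1.
rewrite leNgt; apply/negP; rewrite negbK -[X in _ < X]E.
have := del_lt => d; rewrite gt0_ltr_powR ?nnegrE ?(ltW M_gt0) //; lra.
Qed.

Lemma mahler_powR_sqr_ge : (7 / 2) ^+ n * m ^+ 2 <= M `^ (1 - 2 * del).
Proof.
have -> : 1 - 2 * del = (1 / 2 - del) * 2%:R by lra.
rewrite powRrM powR_mulrn ?powR_ge0 // -s_sqr mulrC -exprMn.
rewrite lerXn2r ?nnegrE ?powR_ge0 ?mahler_powR_ge //.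
exact: le_trans ms_ge1.
Qed.

Lemma mahler_ge : (7 / 2) ^+ n * m ^+ 2 <= M.
Proof.
apply: (le_trans mahler_powR_sqr_ge); apply: ler1_powR mahler_ge1 _.
by have := del_gt0; lra.
Qed.

(** Split [M = M^(1 - 2 del) * M^(2 del)]; the first factor is at least [(7/2)^n m^2], and
    [(7/5)^n >= 2]. *)
Lemma mahler_ratio_ge : M `^ (2 * del) <= M / (2 * m * (5 / 2) ^+ n).
Proof.
have p0 : 0 < (5 / 2 : R) ^+ n by rewrite exprn_gt0 //; lra.
have m0 : 0 < m := lt_le_trans ltr01 m_ge1.
rewrite ler_pdivlMr ?mulr_gt0 //.
have ME : M `^ (1 - 2 * del) * M `^ (2 * del) = M.
  by rewrite -powRD ?subrK ?powRr1 ?(ltW M_gt0) // gt_eqF.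
rewrite -[X in _ <= X]ME mulrC ler_pM2r ?powR_gt0 //.
apply: le_trans mahler_powR_sqr_ge.
have -> : (7 / 2 : R) ^+ n = (7 / 5) ^+ n * (5 / 2) ^+ n.
  by rewrite -exprMn; congr (_ ^+ _); field.
have h : 2 <= (7 / 5 : R) ^+ n.
  apply: (@le_trans _ _ ((7 / 5) ^+ 3)); first by lra.
  by apply: ler_weXn2l => //; lra.
have -> : 2 * m * (5 / 2) ^+ n = 2 * (5 / 2) ^+ n * m by ring.
apply: ler_pM; rewrite ?mulr_ge0 ?(ltW p0) ?(ltW m0) ?ler_pM2r //.
by rewrite expr2 ler_peMr // ltW.
Qed.

(** Logarithms give [2 del c ln M <= 2 n ln M], with [ln M > 0]. *)
Lemma card_le_of_powR (c : nat) :
  (M / (2 * m * (5 / 2) ^+ n)) ^+ c <= (M ^+ 2) ^+ n -> c%:R <= n%:R / del.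
Proof.
move=> h; have d0 := del_gt0.
have M1 : 1 < M.
  apply: lt_le_trans mahler_ge; apply: (@lt_le_trans _ _ ((7 / 2) ^+ n)).
    by rewrite exprn_egt1 //; [case: n n_ge3 | lra].
  by rewrite ler_peMr ?exprn_ge0 ?exprn_ege1 //; lra.
have h1 : (M `^ (2 * del)) ^+ c <= (M ^+ 2) ^+ n.
  apply: le_trans h; rewrite lerXn2r ?nnegrE ?powR_ge0 ?mahler_ratio_ge //.
  exact: (le_trans (powR_ge0 _ _) mahler_ratio_ge).
rewrite ler_pdivlMr //.
have lM : 0 < ln M by rewrite ln_gt0.
have : ln ((M `^ (2 * del)) ^+ c) <= ln ((M ^+ 2) ^+ n).
  by rewrite ler_ln ?posrE ?exprn_gt0 ?powR_gt0.
rewrite -exprM !lnXn ?powR_gt0 // ln_powR.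
rewrite -(mulr_natr (2 * del * ln M)) -(mulr_natr (ln M)) natrM => h2.
have : 2 * ln M * (c%:R * del) <= 2 * ln M * n%:R by lra.
by rewrite ler_pM2l ?mulr_gt0.
Qed.

End PowerBounds.

(** * Passage from families of points to classes of solutions up to sign *)

Theorem theorem1p3 (R : realType) (n : nat) (F : mpoly.mpoly 2 int)
    (D : R[i]) (eps : R) (m : int) :
  (3 <= n)%N ->
  binary_form n F ->
  reducible F ->
  has_discriminant n F D ->
  (exists2 k : nat, max_num_linear_factors R F k & (3 <= k)%N)
    \/ product_of_two_rational_powers F ->
  0 < eps ->
  eps < 1 / (4 * (n%:R - 1)) ->
  0 < m ->
  m%:~R <= (ComplexField.Normc.normc D) `^ (1 / (4 * (n%:R - 1)) - eps)
           / ((7 / 2) `^ (n%:R / 2) * n%:R `^ (n%:R / (4 * (n%:R - 1)))) ->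
  at_most (primitive_solutions_up_to_sign F m)
    (2 * n%:R + n%:R / (2 * (n%:R - 1) * eps)).
Proof.
move=> n3 [_ Fhom] Fred [a [b [FE DE]]] _ eps0 eps1 m0 m_le.
have n1 : (1 < n)%N by apply: ltnW.
have m1 : 1 <= m%:~R :> R by rewrite -[1]/(1%:~R) ler_int -gtz0_ge1.
pose N := @ComplexField.Normc.normc R.
have DN : N D = disc N a b.
  rewrite DE /disc prod_offdiag_sym; last by move=> i j; rewrite /N -normcN /wedge opprB.
  rewrite -prodrXl /N normc_prod; apply: eq_bigr => i _.
  by rewrite -prodrXl normc_prod; apply: eq_bigr => j _; rewrite normcX.
have D0 : 0 <= N D := normc_ge0 D.
have D1 := discriminant_ge1 n3 eps1 m1 D0 m_le.
(* [|D| >= 1] excludes proportional linear factors. *)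
have w0 i j : i != j -> wedge a b i j != 0.
  move=> ij; apply/eqP => wij; move: D1; rewrite -/N DN /disc (bigD1 i) //=.
  rewrite (bigD1 j) 1?eq_sym //= wij /N ComplexField.Normc.normc0 !mul0r.
  by rewrite ler10.
have Dle E1 E2 : cross E1 E2 = 1 ->
    N D <= n%:R ^+ n * height N a b E1 E2 ^+ (n.-1).*2.
  by move=> e12; rewrite DN; apply: disc_le_height.
have H0 E1 E2 : cross E1 E2 = 1 -> 0 < height N a b E1 E2.
  move=> e12; apply: height_gt0 => //.
  - exact: normc_ge0.
  - exact: ComplexField.Normc.eq0_normc.
  - exact: ComplexField.Normc.normcM.
  - exact: normcB.
have [[E1 E2] /= e12 red] := @exists_near_min R _ (fun E => cross E.1 E.2 = 1)
  (fun E => height N a b E.1 E.2) 1 ltr01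
  (fun E e => mahler_ge1 n3 eps0 eps1 m1 D0 m_le (H0 _ _ e) (Dle _ _ e))
  (ex_intro _ ((1, 0), (0, 1)) erefl).
have [A [cA [cB [[cAB cA0 cB0 A0 AT] [dA dB]]]]] := form_split FE Fhom Fred n1 w0.
apply: at_most_of_families => k f fI fS.
have fS' i : exists p, primitive_solution F m p /\ f i = [set p; (- p.1, - p.2)]%classic.
  by have [p Pp <-] := fS i; exists p.
(* The default [(0, 0)] is never taken, since each class has a representative. *)
pose p i := xget (0, 0) [set q |
  primitive_solution F m q /\ f i = [set q; (- q.1, - q.2)]]%classic.
have pP i : primitive_solution F m (p i) /\
    f i = [set p i; (- (p i).1, - (p i).2)]%classic.
  by rewrite /p; case: xgetP => // h; have [q hq] := fS' i; case: (h q).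
have hM := mahler_ge n3 eps0 eps1 m1 D0 m_le (H0 _ _ e12) (Dle _ _ e12).
have hD := discriminant_ge n3 eps0 eps1 m1 D0 m_le; rewrite -/N DN in hD.
have p_prim t : gcdz (p t).1 (p t).2 = 1 by have [[]] := pP t.
have p_sol t : fval N a b (p t) <= m%:~R.
  by rewrite (fval_bin_eval FE) ler_int; have [[]] := pP t.
(* Proportional primitive points are equal or opposite, hence in one class, against injectivity of
   [f]. *)
have p_cross s t : s != t -> cross (p s) (p t) != 0.
  move=> st; apply: contra_neq st => c0; apply: fI.
  have [_ ->] := pP s; have [_ ->] := pP t.
  have [->//|->] := prim_cross_eq0 (p_prim s) (p_prim t) c0.
  by rewrite /= !opprK -surjective_pairing setUC.
have [c [kc hc]] := card_points_le (@normc_ge0 R)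
  (@ComplexField.Normc.eq0_normc R) (@ComplexField.Normc.normcM R) (@normcB R)
  (@normc_int R) e12 n1 w0 m1 n3 hM hD (cross_le_fval FE)
  (fun P P' => red (P, P')) cAB cA0 cB0 A0 AT dA dB p_prim p_sol p_cross.
have := card_le_of_powR n3 eps0 eps1 m1 D0 m_le (H0 _ _ e12) (Dle _ _ e12) hc.
have : k%:R <= (n + n + c)%:R :> R by rewrite ler_nat.
rewrite !natrD; lra.
Qed.
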